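(* For every integer $k \ge 0$, let $C_k \subset \mathbb{R}^{k+4}$ be the cone $$C_k = \left\{ x \in \mathbb{R}^{k+4} : x_4^2 = x_1^2 + x_2^2 + x_3^2 \right\} \cap \bigcap_{l=1}^{k} \left\{ x \in \mathbb{R}^{k+4} : x_{l+4}^2 = 2^l x_4^2 \right\}$$ (for $k=0$ the second intersection is all of $\mathbb{R}^4$). Then for every $x \in C_k$ and every $r>0$, $$\mathcal{H}^3(B(x,r) \cap C_k) = \frac{4}{3}\pi r^3 .$$
   Context: $\mathcal{H}^3$ is 3-dimensional Hausdorff measure, normalized to agree with Lebesgue measure on $\mathbb{R}^3$. $B(x,r)$ is the Euclidean ball of center $x$ and radius $r$ in $\mathbb{R}^{k+4}$. *)

(* Defs.v *)
From mathcomp Require Import all_boot all_order all_algebra.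
From mathcomp Require Import all_classical all_reals all_analysis.
Set Implicit Arguments.
Unset Strict Implicit.
Unset Printing Implicit Defensive.
Import Order.TTheory GRing.Theory Num.Theory.
Local Open Scope classical_set_scope.
Local Open Scope ring_scope.

(* The library's norm on ['rV[R]_n] is the sup norm, hence the explicit
   Euclidean distance, ball and diameter below. *)
Definition eucl_dist (R : realType) (n : nat) (x y : 'rV[R]_n) : R :=
  Num.sqrt (\sum_(i < n) (x ord0 i - y ord0 i) ^+ 2).

Definition eucl_ball (R : realType) (n : nat) (x : 'rV[R]_n) (r : R) :
    set 'rV[R]_n :=
  [set y | eucl_dist x y <= r].

(* The maximum with 0 only matters for the empty set, whose diameter is 0. *)
Definition eucl_diam (R : realType) (n : nat) (U : set 'rV[R]_n) : \bar R :=
  maxe 0%E (ereal_sup [set (eucl_dist p.1 p.2)%:E | p in U `*` U]).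

Definition hausdorff3_delta (R : realType) (n : nat) (delta : R)
    (A : set 'rV[R]_n) : \bar R :=
  ereal_inf [set (\sum_(0 <= i <oo) eucl_diam (U i) ^+ 3)%E |
    U in [set U : nat -> set 'rV[R]_n |
      (forall i, (eucl_diam (U i) <= delta%:E)%E) /\ A `<=` \bigcup_i U i]].

Definition hausdorff3_raw (R : realType) (n : nat) (A : set 'rV[R]_n) :
    \bar R :=
  ereal_sup [set hausdorff3_delta delta A | delta in [set d : R | 0 < d]].

Definition unit_cube3 (R : realType) : set 'rV[R]_3 :=
  [set x : 'rV[R]_3 | forall i : 'I_3, 0 <= x ord0 i <= 1].
Arguments unit_cube3 : clear implicits.

(* On Borel subsets of R^3 [hausdorff3_raw] is a translation-invariant measure
   which is positive and finite on the unit cube, so it is a constant multiple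
   of Lebesgue measure; dividing by its value on the unit cube is the
   normalization for which it equals Lebesgue measure on R^3.  The constant does
   not depend on the dimension n of the ambient space. *)
Definition hausdorff3 (R : realType) (n : nat) (A : set 'rV[R]_n) : \bar R :=
  (hausdorff3_raw A / hausdorff3_raw (unit_cube3 R))%E.

(* [xcoord x j] is the coordinate x_j with 1-based numbering, for
   1 <= j <= m.+1. *)
Definition xcoord (R : realType) (m : nat) (x : 'rV[R]_m.+1) (j : nat) : R :=
  x ord0 (inord j.-1).

(* The ambient space R^(k+4) is written ['rV[R]_k.+4], so that its dimension is
   syntactically a successor. *)
Definition coneC (R : realType) (k : nat) : set 'rV[R]_k.+4 :=
  [set x | xcoord x 4 ^+ 2 = xcoord x 1 ^+ 2 + xcoord x 2 ^+ 2 + xcoord x 3 ^+ 2]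
  `&` \bigcap_(l in [set l : nat | (1 <= l <= k)%N])
        [set x | xcoord x (l + 4) ^+ 2 = 2 ^+ l * xcoord x 4 ^+ 2].
Arguments coneC : clear implicits.

(* Main.v *)
Require Import Defs.
From mathcomp Require Import all_boot all_order all_algebra.
From mathcomp Require Import all_classical all_reals all_analysis.
From mathcomp Require Import ring lra.
Set Implicit Arguments.
Unset Strict Implicit.
Unset Printing Implicit Defensive.
Import Order.TTheory GRing.Theory Num.Theory.
Import numFieldNormedType.Exports.
Local Open Scope classical_set_scope.
Local Open Scope ring_scope.

(** Let N = 2^K.  Over R^3 the cone is the union of the N graphs
    u |-> (u, (eps_l 2^(l/2) |u|)_l), one for each choice of signs.  On a sheet put
    rho = |u|, and let t be the cosine of the angle between u and the base of the
    centre x, of norm alpha.  With A = sqrt(N) alpha and R = sqrt(N) rho, the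
    squared distance to x is R^2 + A^2 - 2 R A v, where
    v = (t + sum_l eps_l 2^l) / N.  The sums of the eps_l 2^l are the odd integers
    between -N and N, so that over all sheets v runs exactly once through [-1, 1].
    In the coordinates z = R^3 / 3, v and the longitude phi, the parametrization
    of each sheet has orthogonal partial derivatives whose lengths have product 1,
    hence it preserves H^3.  Thus the measure of the ball is that of the set
    {R^2 + A^2 - 2 R A v < r^2} of parameters, which depends on N through A only.
    For N = 1 the cone is R^3, where A can be moved to 0 by a translation, and the
    set of parameters is then a box of volume 4/3 pi r^3.

    That such a map f preserves H^3 is proved without measurability: f is
    compared on small dyadic cubes with diagonal linear maps of determinant 1, and
    H^3 is additive on positively separated sets, such as the images of slightly
    shrunk disjoint cubes. *)

(** * The Hausdorff outer measure *)

(** The cone is built so that 1 + sum_(l < K) 2^l = 2^K = N: the lift to a sheet multiplies squared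
    radial lengths by N and leaves tangential ones unchanged. The volume element sqrt(N) rho^2 drho
    dt dphi of a sheet is therefore R^2 dR dt dphi / N = dz dv dphi, where 1 / N is also the share
    of the v-interval that belongs to one sheet. No isodiametric inequality is needed: boxes are
    measured in multiples of [hausdorff3_raw (unit_cube3 R)], a factor that cancels in the
    normalization as soon as it is positive and finite. Preservation of measure is a two-sided
    comparison. Full cells and countable subadditivity bound one image from above; the other is
    bounded from below by finitely many shrunk cubes, because touching cubes leave no gap. The total
    loss is a power of lam > 1, lam is arbitrary, and exchanging the two maps gives equality. The
    places where the coordinates degenerate, namely the walls between consecutive v-intervals and
    the slice x_3 = 0, are null and are discarded. *)

Lemma eucl_dist_ge0 (R : realType) n (x y : 'rV[R]_n) : 0 <= eucl_dist x y.
Proof. exact: sqrtr_ge0. Qed.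

Lemma eucl_distC (R : realType) n (x y : 'rV[R]_n) :
  eucl_dist x y = eucl_dist y x.
Proof.
by congr Num.sqrt; apply: eq_bigr => i _; rewrite -[LHS]sqrrN opprB.
Qed.

Lemma sqr_eucl_dist (R : realType) n (x y : 'rV[R]_n) :
  eucl_dist x y ^+ 2 = \sum_(i < n) (x ord0 i - y ord0 i) ^+ 2.
Proof. by rewrite sqr_sqrtr// sumr_ge0// => i _; rewrite sqr_ge0. Qed.

Lemma coord_le_eucl_dist (R : realType) n (x y : 'rV[R]_n) i :
  `|x ord0 i - y ord0 i| <= eucl_dist x y.
Proof.
rewrite -(@ler_pXn2r _ 2%N)// ?nnegrE ?eucl_dist_ge0// sqr_eucl_dist.
rewrite real_normK ?num_real// (bigD1 i)//= lerDl sumr_ge0// => j _.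
exact: sqr_ge0.
Qed.

Lemma eucl_dist_le_sqr (R : realType) n (x y : 'rV[R]_n) (a : R) :
  0 <= a -> \sum_(i < n) (x ord0 i - y ord0 i) ^+ 2 <= a ^+ 2 ->
  eucl_dist x y <= a.
Proof.
move=> a0 h; rewrite -(@ler_pXn2r _ 2%N)// ?nnegrE ?eucl_dist_ge0//.
by rewrite sqr_eucl_dist.
Qed.

Lemma eucl_diam_ge0 (R : realType) n (U : set 'rV[R]_n) :
  (0 <= eucl_diam U)%E.
Proof. by rewrite le_max lexx. Qed.
#[local] Hint Resolve eucl_diam_ge0 : core.

Lemma eucl_diam_leP (R : realType) n (U : set 'rV[R]_n) (d : \bar R) :
  (0 <= d)%E ->
  (eucl_diam U <= d)%E <->
  (forall x y, U x -> U y -> ((eucl_dist x y)%:E <= d)%E).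
Proof.
move=> d0; rewrite /eucl_diam ge_max d0/=; split => [h x y Ux Uy|h].
  by apply: le_trans h; apply: ereal_sup_ubound; exists (x, y).
by apply: ge_ereal_sup => _ [[x y] [/= Ux Uy] <-]; exact: h.
Qed.

Lemma eucl_dist_le_diam (R : realType) n (U : set 'rV[R]_n) x y :
  U x -> U y -> ((eucl_dist x y)%:E <= eucl_diam U)%E.
Proof.
by move=> Ux Uy; apply: (iffLR (eucl_diam_leP U (eucl_diam_ge0 U)) (lexx _)).
Qed.

Lemma eucl_diam0 (R : realType) n : eucl_diam (@set0 'rV[R]_n) = 0%E.
Proof. by apply/eqP; rewrite eq_le eucl_diam_ge0 andbT; apply/eucl_diam_leP. Qed.

Lemma lee_cube (R : realType) (x y : \bar R) :
  (0 <= x)%E -> (x <= y)%E -> (x ^+ 3 <= y ^+ 3)%E.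
Proof.
move=> x0 xy; rewrite !expeS !expe0 !mule1.
by apply: lee_pmul => //; [exact: mule_ge0|exact: lee_pmul].
Qed.

Lemma cube_eucl_diam_ge0 (R : realType) n (U : set 'rV[R]_n) :
  (0 <= eucl_diam U ^+ 3)%E.
Proof. exact: expe_ge0. Qed.
#[local] Hint Resolve cube_eucl_diam_ge0 : core.

Lemma hausdorff3_delta_ge0 (R : realType) n d (A : set 'rV[R]_n) :
  (0 <= hausdorff3_delta d A)%E.
Proof.
by apply: le_ereal_inf_tmp => _ [U _ <-]; apply: nneseries_ge0.
Qed.

Lemma hausdorff3_delta_le (R : realType) n d (A : set 'rV[R]_n) U :
  (forall i, (eucl_diam (U i) <= d%:E)%E) -> A `<=` \bigcup_i U i ->
  (hausdorff3_delta d A <= \sum_(0 <= i <oo) eucl_diam (U i) ^+ 3)%E.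
Proof. by move=> dU AU; apply: ereal_inf_lbound; exists U. Qed.

Lemma hausdorff3_delta_mono (R : realType) n d (A B : set 'rV[R]_n) :
  A `<=` B -> (hausdorff3_delta d A <= hausdorff3_delta d B)%E.
Proof.
move=> AB; apply: le_ereal_inf_tmp => _ [U [dU BU] <-].
by apply: hausdorff3_delta_le => //; exact: subset_trans BU.
Qed.

Lemma hausdorff3_delta_anti (R : realType) n d e (A : set 'rV[R]_n) :
  d <= e -> (hausdorff3_delta e A <= hausdorff3_delta d A)%E.
Proof.
move=> de; apply: le_ereal_inf_tmp => _ [U [dU BU] <-].
by apply: hausdorff3_delta_le => // i; rewrite (le_trans (dU i)) ?lee_fin.
Qed.

Lemma hausdorff3_delta_one (R : realType) n d (A : set 'rV[R]_n) :
  (eucl_diam A <= d%:E)%E -> (hausdorff3_delta d A <= eucl_diam A ^+ 3)%E.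
Proof.
move=> dA; pose U (i : nat) : set 'rV[R]_n := if i == 0%N then A else set0.
have d0 : (0 <= d%:E)%E by apply: le_trans dA.
have := @hausdorff3_delta_le _ _ d A U.
rewrite nneseries_recl//.
rewrite [X in (_ + X)%E]eseries0 ?adde0; last first.
  by case=> // k _ _; rewrite /U eucl_diam0 expeS mul0e.
apply=> [[|i]|x Ax]; rewrite /U ?eucl_diam0//.
by exists 0%N.
Qed.

Lemma hausdorff3_delta_set0 (R : realType) n d :
  0 < d -> hausdorff3_delta d (@set0 'rV[R]_n) = 0%E.
Proof.
move=> d0; apply/eqP; rewrite eq_le hausdorff3_delta_ge0 andbT.
have := @hausdorff3_delta_one R n d set0.
by rewrite eucl_diam0 lee_fin (ltW d0) !expeS mul0e; apply.
Qed.

Lemma hausdorff3_delta_subadd (R : realType) n d (A : nat -> set 'rV[R]_n) :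
  (hausdorff3_delta d (\bigcup_i A i) <=
   \sum_(0 <= i <oo) hausdorff3_delta d (A i))%E.
Proof.
have h0 i := hausdorff3_delta_ge0 d (A i).
(* An infinite term makes the bound trivial; otherwise every infimum is finite and is approached by
   a cover up to e / 2^(k+1). *)
have [[i ioo]|] := pselect (exists i, hausdorff3_delta d (A i) = +oo%E).
  rewrite (eseries_pinfty _ _ ioo) ?leey// => k _.
  by rewrite -ltNye (lt_le_trans _ (h0 _)).
rewrite -forallNE => Aoo.
apply/lee_addgt0Pr => e e0.
apply: le_trans (epsilon_trick _ h0 (ltW e0)).
pose P k (B : nat -> set 'rV[R]_n) :=
  ((forall i, (eucl_diam (B i) <= d%:E)%E) /\ A k `<=` \bigcup_i B i) /\
  (\sum_(0 <= i <oo) eucl_diam (B i) ^+ 3 <=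
   hausdorff3_delta d (A k) + (e / (2 ^ k.+1)%:R)%:E)%E.
have [G PG] : {G : nat -> nat -> set 'rV[R]_n & forall k, P k (G k)}.
  apply: (@choice _ _ P) => k.
  have en1 : 0 < e / (2 ^ k.+1)%:R by rewrite divr_gt0// ltr0n expn_gt0.
  have : hausdorff3_delta d (A k) \is a fin_num.
    by rewrite ge0_fin_numE// ltey; apply/eqP.
  by move=> /(lb_ereal_inf_adherent en1)[_ [B PB <-]] /ltW; exists B.
(* The sequence of covers is flattened into a single cover by a bijection from nat to pairs. *)
have /card_esym/ppcard_eqP[f] := card_nat2.
have finj : set_bij [set: nat] [set: nat * nat] f by exact: 'bij_f.
pose m (k : nat * nat) := (eucl_diam (G k.1 k.2) ^+ 3)%E.
apply: (@le_trans _ _ (\sum_(0 <= i <oo) m (f i))%E).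
  apply: (@hausdorff3_delta_le _ _ _ _ (fun i => G (f i).1 (f i).2))
    => [i|x [k _ /(PG k).1.2[j _ Gx]]].
    exact: (PG _).1.1.
  have [_ _ /(_ (k, j) I)[i _ fi]] := finj.
  by exists i => //; rewrite fi.
rewrite (nneseries_esumT (a := m \o f)); last first.
  by move=> ?; exact: cube_eucl_diam_ge0.
rewrite /= -(reindex_esum _ _ _ m finj).
rewrite (_ : [set: nat * nat] = [set: nat] `*`` (fun=> [set: nat])); last first.
  by apply/seteqP; split.
rewrite /m -(esum_esum (a := fun i j => (eucl_diam (G i j) ^+ 3)%E)); last first.
  by move=> *; exact: cube_eucl_diam_ge0.
rewrite nneseries_esumT; last first.
  by move=> k; rewrite adde_ge0// lee_fin divr_ge0// ltW.
apply: le_esum => k _; rewrite -nneseries_esumT; last first.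
  by move=> ?; exact: cube_eucl_diam_ge0.
exact: (PG k).2.
Qed.

Lemma hausdorff3_raw_ge_delta (R : realType) n d (A : set 'rV[R]_n) :
  0 < d -> (hausdorff3_delta d A <= hausdorff3_raw A)%E.
Proof. by move=> d0; apply: ereal_sup_ubound; exists d. Qed.

Lemma hausdorff3_raw_leP (R : realType) n (A : set 'rV[R]_n) (M : \bar R) :
  (forall d, 0 < d -> (hausdorff3_delta d A <= M)%E) ->
  (hausdorff3_raw A <= M)%E.
Proof. by move=> h; apply: ge_ereal_sup => _ [d d0 <-]; exact: h. Qed.

Lemma hausdorff3_raw_ge0 (R : realType) n (A : set 'rV[R]_n) :
  (0 <= hausdorff3_raw A)%E.
Proof.
exact: le_trans (hausdorff3_delta_ge0 1 A) (hausdorff3_raw_ge_delta A ltr01).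
Qed.
#[local] Hint Resolve hausdorff3_raw_ge0 : core.

Lemma hausdorff3_raw_mono (R : realType) n (A B : set 'rV[R]_n) :
  A `<=` B -> (hausdorff3_raw A <= hausdorff3_raw B)%E.
Proof.
move=> AB; apply: hausdorff3_raw_leP => d d0.
exact: le_trans (hausdorff3_delta_mono d AB) (hausdorff3_raw_ge_delta _ d0).
Qed.

Lemma hausdorff3_raw_set0 (R : realType) n :
  hausdorff3_raw (@set0 'rV[R]_n) = 0%E.
Proof.
apply/eqP; rewrite eq_le hausdorff3_raw_ge0 andbT.
by apply: hausdorff3_raw_leP => d d0; rewrite hausdorff3_delta_set0.
Qed.

Lemma hausdorff3_raw_subadd (R : realType) n (A : nat -> set 'rV[R]_n) :
  (hausdorff3_raw (\bigcup_i A i) <=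
   \sum_(0 <= i <oo) hausdorff3_raw (A i))%E.
Proof.
apply: hausdorff3_raw_leP => d d0.
apply: le_trans (hausdorff3_delta_subadd _ _) _.
apply: lee_nneseries => [i _ _|i _]; first exact: hausdorff3_delta_ge0.
exact: hausdorff3_raw_ge_delta.
Qed.

Lemma hausdorff3_delta_subadd_fin (R : realType) n d (I : finType)
    (A : I -> set 'rV[R]_n) : 0 < d ->
  (hausdorff3_delta d (\bigcup_i A i) <= \sum_i hausdorff3_delta d (A i))%E.
Proof.
move=> d0.
pose B j := if insub j is Some i then A (enum_val (i : 'I_#|I|)) else set0.
have BE (i : I) : B (enum_rank i) = A i by rewrite /B insubT// => ?;
  rewrite /= -[in RHS](enum_rankK i); congr (A (enum_val _)); exact: val_inj.
have AB : \bigcup_i A i `<=` \bigcup_j B j.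
  by move=> x [i _ Ax]; exists (enum_rank i) => //; rewrite BE.
apply: le_trans (hausdorff3_delta_mono d AB) _.
apply: le_trans (hausdorff3_delta_subadd _ _) _.
rewrite (nneseries_split 0%N #|I|); last by move=> *; exact: hausdorff3_delta_ge0.
rewrite [X in (_ + X)%E]eseries0 ?adde0; last first.
  by move=> k ki _; rewrite /B insubF ?hausdorff3_delta_set0//; apply/negbTE;
     rewrite -leqNgt.
rewrite add0n big_mkord (reindex_onto (@enum_rank I) enum_val)/=; last first.
  by move=> i _; rewrite enum_valK.
rewrite (eq_bigl predT); last by move=> i; rewrite enum_rankK eqxx.
by apply: lee_sum => i _; rewrite BE.
Qed.

Lemma hausdorff3_raw_subadd_fin (R : realType) n (I : finType)
    (A : I -> set 'rV[R]_n) :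
  (hausdorff3_raw (\bigcup_i A i) <= \sum_i hausdorff3_raw (A i))%E.
Proof.
apply: hausdorff3_raw_leP => d d0.
apply: le_trans (hausdorff3_delta_subadd_fin _ d0) _.
by apply: lee_sum => i _; exact: hausdorff3_raw_ge_delta.
Qed.

Lemma hausdorff3_raw_setU (R : realType) n (A B : set 'rV[R]_n) :
  (hausdorff3_raw (A `|` B) <= hausdorff3_raw A + hausdorff3_raw B)%E.
Proof.
have := hausdorff3_raw_subadd_fin (fun b : bool => if b then A else B).
rewrite big_bool/=; apply: le_trans; apply: hausdorff3_raw_mono.
by move=> x [?|?]; [exists true|exists false].
Qed.

Lemma hausdorff3_raw_addnull (R : realType) n (A B Z : set 'rV[R]_n) :
  hausdorff3_raw Z = 0%E -> A `<=` B -> B `<=` A `|` Z ->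
  hausdorff3_raw B = hausdorff3_raw A.
Proof.
move=> Z0 AB BA; apply/eqP; rewrite eq_le [X in _ && X]hausdorff3_raw_mono// andbT.
apply: le_trans (hausdorff3_raw_mono BA) _.
by apply: le_trans (hausdorff3_raw_setU _ _) _; rewrite Z0 adde0.
Qed.

Definition pos_separated (R : realType) n (A B : set 'rV[R]_n) :=
  exists2 eta : R, 0 < eta & forall x y, A x -> B y -> eta <= eucl_dist x y.

(** A covering set of diameter less than the gap [eta] meets at most one of [A] and [B], so a fine
    cover of the union splits into a cover of each. This is Caratheodory's metric condition, used
    here directly in place of measurability. *)
Lemma hausdorff3_raw_separated (R : realType) n (A B : set 'rV[R]_n) :
  pos_separated A B ->
  (hausdorff3_raw A + hausdorff3_raw B <= hausdorff3_raw (A `|` B))%E.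
Proof.
move=> [eta eta0 AB].
have key d : 0 < d -> d < eta ->
    (hausdorff3_delta d A + hausdorff3_delta d B <= hausdorff3_raw (A `|` B))%E.
  move=> d0 deta; apply: le_trans (hausdorff3_raw_ge_delta _ d0).
  apply: le_ereal_inf_tmp => _ [U [dU ABU] <-].
  pose V (S : set 'rV[R]_n) i := if `[< U i `&` S !=set0 >] then U i else set0.
  have Vd S i : (eucl_diam (V S i) <= d%:E)%E.
    by rewrite /V; case: ifP => // _; rewrite eucl_diam0 lee_fin ltW.
  have SV S : S `<=` A `|` B -> S `<=` \bigcup_i V S i.
    move=> SAB x Sx; have [i _ Ux] := ABU _ (SAB _ Sx).
    by exists i => //; rewrite /V ifT//; apply/asboolP; exists x.
  apply: (@le_trans _ _ (\sum_(0 <= i <oo)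
      (eucl_diam (V A i) ^+ 3 + eucl_diam (V B i) ^+ 3))%E).
    rewrite nneseriesD//; by apply: leeD; apply: hausdorff3_delta_le => //;
      apply: SV; (exact: subsetUl || exact: subsetUr).
  apply: lee_nneseries => [i _ _|i _]; first exact: adde_ge0.
  rewrite /V; case: ifPn => [/asboolP[x [Ux Ax]]|_]; last first.
    rewrite eucl_diam0 [X in (X + _)%E]expeS mul0e add0e.
    by case: ifP => // _; rewrite eucl_diam0 expeS mul0e cube_eucl_diam_ge0.
  rewrite ifF; first by rewrite eucl_diam0 [X in (_ + X)%E]expeS mul0e adde0.
  apply/asboolPn => -[y [Uy By]].
  have := le_trans (eucl_dist_le_diam Ux Uy) (dU i).
  by rewrite lee_fin leNgt (lt_le_trans deta)// AB.
(* Two independent scales, so that the suprema over [d] and over [e] can be taken one after the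
   other. *)
have key2 d e : 0 < d -> 0 < e ->
    (hausdorff3_delta d A + hausdorff3_delta e B <= hausdorff3_raw (A `|` B))%E.
  move=> d0 e0; pose m := Num.min (eta / 2) (Num.min d e).
  have m0 : 0 < m by rewrite !lt_min divr_gt0//= d0.
  apply: le_trans (key m m0 _).
    apply: leeD; apply: hausdorff3_delta_anti; rewrite !ge_min lexx ?orbT//.
  by rewrite gt_min; apply/orP; left; rewrite ltr_pdivrMr// ltr_pMr// ltr1n.
have [Boo|Boo] := eqVneq (hausdorff3_raw (A `|` B)) +oo%E; first by rewrite Boo leey.
have fin_le S : S `<=` A `|` B -> hausdorff3_raw S \is a fin_num.
  move=> SAB; rewrite ge0_fin_numE//.
    by rewrite (le_lt_trans (hausdorff3_raw_mono SAB))// ltey.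
  exact: hausdorff3_raw_ge0.
have fA := fin_le _ (@subsetUl _ A B).
have fB := fin_le _ (@subsetUr _ A B).
rewrite -leeBrDr//; apply: hausdorff3_raw_leP => d d0.
rewrite leeBrDr// addeC -leeBrDr//; last first.
  by rewrite ge0_fin_numE ?hausdorff3_delta_ge0//
    (le_lt_trans (hausdorff3_raw_ge_delta A d0))// ltey_eq fA.
apply: hausdorff3_raw_leP => e e0; rewrite leeBrDr; first by rewrite addeC key2.
by rewrite ge0_fin_numE ?hausdorff3_delta_ge0//
    (le_lt_trans (hausdorff3_raw_ge_delta A d0))// ltey_eq fA.
Qed.

Lemma hausdorff3_raw_separated_sum (R : realType) n (B : nat -> set 'rV[R]_n) N :
  (forall i j, i <> j -> pos_separated (B i) (B j)) ->
  (\sum_(i < N) hausdorff3_raw (B i) <=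
   hausdorff3_raw (\bigcup_(i in `I_N) B i))%E.
Proof.
move=> sepB; elim: N => [|N IH]; first by rewrite big_ord0 hausdorff3_raw_ge0.
rewrite big_ord_recr/=.
have -> : \bigcup_(i in `I_N.+1) B i = \bigcup_(i in `I_N) B i `|` B N.
  by rewrite IIS bigcup_setU bigcup_set1.
apply: le_trans (leeD2r _ IH) _; apply: hausdorff3_raw_separated.
suff gen M : (M <= N)%N -> pos_separated (\bigcup_(i in `I_M) B i) (B N).
  exact: gen.
elim: M => [_|M IHM MN]; first by exists 1 => // x y [].
have [e e0 he] := IHM (ltnW MN).
have [f f0 hf] : pos_separated (B M) (B N).
  by apply: sepB => MNe; rewrite MNe ltnn in MN.
exists (Num.min e f); first by rewrite lt_min e0.
move=> x y [i /= iM Bx] By; rewrite ge_min.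
move: iM; rewrite ltnS leq_eqVlt => /orP[/eqP iM|iM].
  by rewrite hf ?orbT// -iM.
by rewrite he//; exists i.
Qed.

(* The Lipschitz map is [psi \o phi^-1], which need not be defined globally. *)
Lemma hausdorff3_raw_lipschitz (R : realType) (T : Type) n m (A : set T)
    (phi : T -> 'rV[R]_n) (psi : T -> 'rV[R]_m) (L : R) : 0 < L ->
  (forall p q, A p -> A q ->
     eucl_dist (psi p) (psi q) <= L * eucl_dist (phi p) (phi q)) ->
  (hausdorff3_raw (psi @` A) <= (L ^+ 3)%:E * hausdorff3_raw (phi @` A))%E.
Proof.
move=> L0 lip; apply: hausdorff3_raw_leP => d d0.
have dL0 : 0 < d / L by rewrite divr_gt0.
have L30 : 0 < L ^+ 3 by rewrite exprn_gt0.
apply: (@le_trans _ _ ((L ^+ 3)%:E * hausdorff3_delta (d / L) (phi @` A))%E);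
  last by rewrite lee_pmul2l// hausdorff3_raw_ge_delta.
rewrite -lee_pdivrMl//; apply: le_ereal_inf_tmp => _ [U [dU AU] <-].
rewrite lee_pdivrMl// -nneseriesZl//.
pose V i := psi @` (A `&` phi @^-1` U i).
have VU i : (eucl_diam (V i) <= L%:E * eucl_diam (U i))%E.
  apply/eucl_diam_leP; first by rewrite mule_ge0// lee_fin ltW.
  move=> _ _ [p [Ap Up] <-] [q [Aq Uq] <-].
  apply: (@le_trans _ _ (L%:E * (eucl_dist (phi p) (phi q))%:E)%E).
    by rewrite -EFinM lee_fin lip.
  by rewrite lee_pmul2l ?lte_fin// eucl_dist_le_diam.
apply: (@le_trans _ _ (\sum_(0 <= i <oo) eucl_diam (V i) ^+ 3)%E).
  apply: hausdorff3_delta_le => [i|_ [p Ap <-]].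
    apply: le_trans (VU i) _; rewrite -lee_pdivlMl// (le_trans (dU i))//.
    by rewrite -EFinM lee_fin mulrC.
  by have [|i _ Ui] := AU (phi p); [exists p|exists i => //; exists p].
apply: lee_nneseries => [i _ _|i _]; first exact: cube_eucl_diam_ge0.
apply: le_trans (lee_cube _ (VU i)) _ => //.
set x := eucl_diam _; rewrite EFin_expe !expeS !expe0 !mule1.
by rewrite (muleACA L%:E x L%:E x) (muleACA L%:E x (L%:E * L%:E)%E (x * x)%E).
Qed.

Lemma hausdorff3_raw_isometry (R : realType) (T : Type) n m (A : set T)
    (phi : T -> 'rV[R]_n) (psi : T -> 'rV[R]_m) :
  (forall p q, A p -> A q ->
     eucl_dist (psi p) (psi q) = eucl_dist (phi p) (phi q)) ->
  hausdorff3_raw (psi @` A) = hausdorff3_raw (phi @` A).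
Proof.
move=> iso; apply/eqP; rewrite eq_le; apply/andP; split;
  rewrite -[leRHS]mul1e -[X in (X%:E * _)%E](expr1n R 3);
  by apply: hausdorff3_raw_lipschitz => // p q Ap Aq; rewrite mul1r iso.
Qed.

(** * Boxes in R^3 *)

(** Meant for the measure of a box as a function of one edge. Touching slabs are not positively
    separated, so superadditivity is available only across a gap [e]; monotonicity absorbs the
    gaps. *)
Lemma linear_of_gap_additive (R : realType) (f : R -> R) :
  (forall s, 0 <= s -> 0 <= f s) ->
  (forall s t, 0 <= s -> s <= t -> f s <= f t) ->
  (forall s t, 0 <= s -> 0 <= t -> f (s + t) <= f s + f t) ->
  (forall s t e, 0 <= s -> 0 <= t -> 0 < e -> f s + f t <= f (s + t + e)) ->
  forall t, 0 <= t -> f t = t * f 1.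
Proof.
move=> f0 fmono fsub fsup.
have fsubn n s : 0 <= s -> f (n.+1%:R * s) <= n.+1%:R * f s.
  move=> s0; elim: n => [|n IH]; first by rewrite !mul1r.
  rewrite -natr1 !mulrDl !mul1r; apply: le_trans (fsub _ _ _ s0) _.
    by rewrite mulr_ge0.
  by rewrite lerD2r.
have fsupn n s e : 0 <= s -> 0 < e -> n.+1%:R * f s <= f (n.+1%:R * s + e).
  move=> s0; elim: n e => [|n IH] e e0.
    by rewrite !mul1r fmono// lerDl ltW.
  rewrite -natr1 !mulrDl !mul1r.
  have e20 : 0 < e / 2 by rewrite divr_gt0.
  apply: (@le_trans _ _ (f (n.+1%:R * s + e / 2) + f s)).
    by rewrite lerD2r IH.
  have -> : n.+1%:R * s + s + e = n.+1%:R * s + e / 2 + s + e / 2 by lra.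
  by apply: fsup => //; rewrite addr_ge0// ?mulr_ge0// ltW.
have key s t : 0 < s -> 0 <= t -> s * f t <= t * f s.
  move=> s0 t0; rewrite leNgt; apply/negP => h.
  set d := s * f t - t * f s; have d0 : 0 < d by rewrite subr_gt0.
  (* [n.+1] copies of [t], with gaps of total length [s], fit into [M.+2] copies of [s], which
     exceed [n.+1 * t] by at most 2 s. The choice of [n] makes the accumulated defect [n.+1 * d]
     larger than the cost [2 * s * f s] of this excess. *)
  pose n := Num.truncn (2 * s * f s / d).
  have hn : 2 * s * f s < n.+1%:R * d.
    by rewrite -ltr_pdivrMr// truncnS_gt.
  pose M := Num.truncn (n.+1%:R * t / s).
  have M0 : 0 <= n.+1%:R * t / s by rewrite divr_ge0 ?mulr_ge0// ltW.
  have /andP[M1 M2] := truncn_itv M0.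
  rewrite -/M in M1 M2.
  rewrite ler_pdivlMr// in M1; rewrite ltr_pdivrMr// in M2.
  have h1 := fsupn n t s t0 s0.
  have h2 := fsubn M.+1 s (ltW s0).
  have h3 : f (n.+1%:R * t + s) <= f (M.+2%:R * s).
    apply: fmono; first by rewrite addr_ge0 ?mulr_ge0// ltW.
    by rewrite -[M.+2%:R]natr1 mulrDl mul1r lerD2r ltW.
  have h4 : n.+1%:R * f t <= M.+2%:R * f s by apply: le_trans h2; apply: le_trans h3.
  have fs0 : 0 <= f s by rewrite f0// ltW.
  have h5 : s * (n.+1%:R * f t) <= (M%:R * s + 2 * s) * f s.
    apply: (@le_trans _ _ (s * (M.+2%:R * f s))); first by rewrite ler_pM2l.
    by rewrite -[M.+2%:R]natr1 -[M.+1%:R]natr1; lra.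
  have h6 : (M%:R * s + 2 * s) * f s <= (n.+1%:R * t + 2 * s) * f s.
    by rewrite ler_wpM2r// lerD2r.
  rewrite /d in hn; nra.
move=> t t0; apply/eqP; rewrite eq_le; apply/andP; split.
  by have := key 1 t ltr01 t0; rewrite mul1r.
have [->|tN0] := eqVneq t 0; first by rewrite mul0r f0.
by have := @key t 1 _ ler01; rewrite mul1r; apply; rewrite lt0r tN0.
Qed.

Definition box3 (R : realType) (lo hi : 'I_3 -> R) : set 'rV[R]_3 :=
  [set x | forall i, lo i <= x ord0 i <= hi i].

Lemma unit_cube3E (R : realType) :
  unit_cube3 R = box3 (fun=> 0%R) (fun=> 1).
Proof. by []. Qed.

Lemma box3_translate (R : realType) (lo hi : 'I_3 -> R) :
  hausdorff3_raw (box3 lo hi) =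
  hausdorff3_raw (box3 (fun=> 0%R) (fun i => hi i - lo i)).
Proof.
pose tr (x : 'rV[R]_3) : 'rV[R]_3 := \row_i (x ord0 i - lo i).
have -> : box3 (fun=> 0%R) (fun i => hi i - lo i) = tr @` box3 lo hi.
  apply/seteqP; split => [x hx|_ [x hx <-] i]; last first.
    by rewrite !mxE subr_ge0 lerD2r.
  exists (\row_i (x ord0 i + lo i)).
    by move=> i; rewrite mxE -lerBlDr subrr -lerBrDr.
  by apply/rowP => i; rewrite !mxE addrK.
rewrite -[in LHS](image_id (box3 lo hi)); apply/esym/hausdorff3_raw_isometry.
move=> p q _ _; congr Num.sqrt; apply: eq_bigr => i _; rewrite !mxE.
by congr (_ ^+ 2); lra.
Qed.

Lemma box3_diam_le (R : realType) (lo hi : 'I_3 -> R) (h : R) :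
  0 <= h -> (forall i, hi i - lo i <= h) ->
  (eucl_diam (box3 lo hi) <= (3 * h)%:E)%E.
Proof.
move=> h0 hh; apply/eucl_diam_leP; first by rewrite lee_fin mulr_ge0.
move=> x y bx by_; rewrite lee_fin; apply: eucl_dist_le_sqr.
  by rewrite mulr_ge0.
apply: (@le_trans _ _ (\sum_(i < 3) h ^+ 2)).
  apply: ler_sum => i _; have := bx i; have := by_ i; have := hh i.
  move=> ? /andP[? ?] /andP[? ?].
  rewrite -[X in X ^+ 2 <= _]opprB sqrrN -(real_normK (num_real _)).
  by rewrite ler_pXn2r ?nnegrE// ler_norml; apply/andP; split; lra.
by rewrite sumr_const card_ord exprMn -mulr_natl; have := sqr_ge0 h; lra.
Qed.

(** The m^3 cells of side 1 / m have diameter at most 3 / m, a crude bound for sqrt(3) / m, so their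
    cubed diameters add up to at most 27 at every scale. *)
Lemma unit_cube3_lty (R : realType) :
  (hausdorff3_raw (unit_cube3 R) < +oo)%E.
Proof.
apply: (@le_lt_trans _ _ 27%:E%E); last by rewrite ltry.
apply: hausdorff3_raw_leP => d d0.
pose m := (Num.truncn (3 / d)).+1.
have m0 : 0 < m%:R :> R by rewrite ltr0n.
have md : 3 * m%:R^-1 <= d.
  by rewrite ler_pdivrMr// mulrC -ler_pdivrMr// ltW// truncnS_gt.
pose C (f : {ffun 'I_3 -> 'I_m}) : set 'rV[R]_3 :=
  box3 (fun i => (f i)%:R / m%:R) (fun i => (f i).+1%:R / m%:R).
have Cd f : (eucl_diam (C f) <= (3 * m%:R^-1)%:E)%E.
  apply: box3_diam_le => [|i]; first by rewrite invr_ge0 ltW.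
  by rewrite -natr1 mulrDl mul1r addrC addKr.
have cov : unit_cube3 R `<=` \bigcup_f C f.
  move=> x hx.
  (* [minn] assigns the points of the face x_i = 1 to the last cell. *)
  have hm (i : 'I_3) : (minn (Num.truncn (x ord0 i * m%:R)) m.-1 < m)%N.
    by rewrite /m/= gtn_min leqnn orbT.
  exists [ffun i => Ordinal (hm i)] => // i; rewrite !ffunE/=.
  have /andP[x0 x1] := hx i.
  have xm0 : 0 <= x ord0 i * m%:R by rewrite mulr_ge0// ltW.
  have /andP[t1 t2] := truncn_itv xm0.
  rewrite ler_pdivrMr// ler_pdivlMr//; apply/andP; split.
    by apply: le_trans t1; rewrite ler_nat geq_minl.
  rewrite /minn; case: ifP => _; first exact: ltW.
  by rewrite /m/= -/m -[leRHS]mul1r ler_pM2r.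
apply: le_trans (hausdorff3_delta_mono _ cov) _.
apply: le_trans (hausdorff3_delta_subadd_fin _ d0) _.
apply: (@le_trans _ _ (\sum_(f : {ffun 'I_3 -> 'I_m}) (27 / m%:R ^+ 3)%:E)%E).
  apply: lee_sum => f _; apply: le_trans (hausdorff3_delta_one _) _.
    by apply: le_trans (Cd f) _; rewrite lee_fin.
  apply: le_trans (lee_cube (eucl_diam_ge0 _) (Cd f)) _.
  by rewrite -EFin_expe lee_fin exprMn exprVn; lra.
rewrite sumEFin sumr_const card_ffun !card_ord lee_fin.
by rewrite -(mulr_natl (27 / _)) natrX mulrCA mulfV ?mulr1// expf_neq0// gt_eqF.
Qed.

(** Comparison with Lebesgue measure: a set of diameter d lies in the cube of side 2 d centred at
    any of its points, of volume 8 d^3. By countable subadditivity a cover of the unit cube has sum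
    of cubed diameters at least 1 / 8. *)
Lemma unit_cube3_gt0 (R : realType) :
  (0 < hausdorff3_raw (unit_cube3 R))%E.
Proof.
apply: (@lt_le_trans _ _ (8^-1)%:E); first by rewrite lte_fin.
apply: le_trans (hausdorff3_raw_ge_delta _ ltr01).
apply: le_ereal_inf_tmp => _ [U [dU cU] <-].
rewrite -[X in (X <= _)%E]mule1 lee_pdivrMl// -nneseriesZl; last first.
  by move=> *; exact: cube_eucl_diam_ge0.
pose mu := ((@lebesgue_measure R \x @lebesgue_measure R) \x @lebesgue_measure R)%E.
pose i1 : 'I_3 := inord 1. pose i2 : 'I_3 := inord 2.
have muX (a b c r : R) : 0 <= r ->
    mu ((`[a - r, a + r]%classic `*` `[b - r, b + r]%classic) `*`
        `[c - r, c + r]%classic) = ((2 * r) ^+ 3)%:E.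
  move=> r0; rewrite /mu product_measure1E//; last exact: measurableX.
  rewrite /= product_measure1E//= !lebesgue_measure_itv/= !lte_fin.
  have e x : x + r - (x - r) = 2 * r by lra.
  have [->|rN0] := eqVneq r 0.
    by rewrite !subr0 !addr0 !ltxx !mule0 mulr0 expr0n.
  have h x : x - r < x + r by rewrite ltrD2l gt0_cp// lt0r rN0.
  by rewrite !h -!EFinB -!EFinM !e; congr EFin; ring.
pose V i : set (measurableTypeR R * measurableTypeR R * measurableTypeR R) :=
  if pselect (U i !=set0) is left ne then
    let p := projT1 (cid ne) in let r := fine (eucl_diam (U i)) in
    (`[p ord0 ord0 - r, p ord0 ord0 + r]%classic `*`
     `[p ord0 i1 - r, p ord0 i1 + r]%classic) `*`
    `[p ord0 i2 - r, p ord0 i2 + r]%classic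
  else set0.
have dfin i : eucl_diam (U i) \is a fin_num.
  by rewrite ge0_fin_numE ?eucl_diam_ge0// (le_lt_trans (dU i))// ltry.
have muV i : (mu (V i) <= 8%:E * eucl_diam (U i) ^+ 3)%E.
  rewrite /V; case: pselect => [ne|_]; last first.
    rewrite (_ : mu set0 = 0%E); last exact: measure0.
    by rewrite mule_ge0// cube_eucl_diam_ge0.
  rewrite muX ?fine_ge0 ?eucl_diam_ge0// -(fineK (dfin i)) -EFin_expe -EFinM lee_fin.
  by rewrite exprMn; lra.
apply: (@le_trans _ _ (\sum_(0 <= i <oo) mu (V i))%E); last first.
  by apply: lee_nneseries => [i _ _|i _]; [exact: measure_ge0|exact: muV].
have <- : mu ((`[0, 1]%classic `*` `[0, 1]%classic) `*` `[0, 1]%classic) = 1%E.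
  rewrite /mu product_measure1E//; last exact: measurableX.
  rewrite /= product_measure1E//= !lebesgue_measure_itv/= !lte_fin ltr01.
  by rewrite oppr0 adde0 !mule1.
apply: measure_sigma_subadditive.
- move=> i; rewrite /V; case: pselect => // ne.
  by apply: measurableX => //; exact: measurableX.
- by apply: measurableX => //; exact: measurableX.
- move=> [[a b] c] [[/= a01 b01] /= c01].
  pose x : 'rV[R]_3 := \row_i (if i == ord0 then a else if i == i1 then b else c).
  have [|i _ Ux] := cU x.
    move=> i; rewrite mxE; case: ifP => _; first by rewrite in_itv/= in a01.
    by case: ifP => _; [rewrite in_itv/= in b01|rewrite in_itv/= in c01].
  exists i => //; rewrite /V; case: pselect => [ne|[]]; last by exists x.
  case: cid => p Up /=.
  have near j : p ord0 j - fine (eucl_diam (U i)) <= x ord0 j <=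
      p ord0 j + fine (eucl_diam (U i)).
    have := eucl_dist_le_diam Up Ux.
    rewrite -(fineK (dfin i)) lee_fin => /(le_trans (coord_le_eucl_dist p x j)).
    by rewrite distrC ler_distl.
  have := near ord0; have := near i1; have := near i2; rewrite !mxE !in_itv/=.
  rewrite -!val_eqE /i1/i2/= !inordK//=.
Qed.

Lemma box3_lty (R : realType) (lo hi : 'I_3 -> R) :
  (hausdorff3_raw (box3 lo hi) < +oo)%E.
Proof.
rewrite box3_translate; set a := fun i => hi i - lo i.
pose M := 1 + \sum_i `|a i|.
have aM i : a i <= M.
  apply: le_trans (ler_norm _) _; rewrite /M (bigD1 i)//= addrCA lerDl.
  by rewrite addr_ge0// sumr_ge0.
have M0 : 0 < M by rewrite ltr_wpDr// sumr_ge0.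
have sub : box3 (fun=> 0%R) a `<=` (fun x => M *: x) @` unit_cube3 R.
  move=> x hx; exists (M^-1 *: x); last by rewrite scalerA mulfV ?scale1r ?gt_eqF.
  move=> i; rewrite mxE; have /andP[h1 h2] := hx i.
  rewrite mulr_ge0//=; last by rewrite invr_ge0 ltW.
  by rewrite mulrC ler_pdivrMr// mul1r (le_trans h2).
apply: le_lt_trans (hausdorff3_raw_mono sub) _.
apply: (@le_lt_trans _ _ ((M ^+ 3)%:E * hausdorff3_raw (id @` unit_cube3 R))%E).
  apply: hausdorff3_raw_lipschitz => // p q _ _.
  apply: eucl_dist_le_sqr; first by rewrite mulr_ge0 ?eucl_dist_ge0// ltW.
  rewrite exprMn sqr_eucl_dist mulr_sumr ler_sum// => i _.
  by rewrite !mxE -mulrBr exprMn.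
by rewrite image_id lte_mul_pinfty ?lee_fin ?exprn_ge0 ?unit_cube3_lty// ltW.
Qed.

Definition upd3 (R : realType) (a : 'I_3 -> R) (i : 'I_3) (s : R) (j : 'I_3) :=
  if j == i then s else a j.

(** As a function of the edge along axis [i], the measure fits [linear_of_gap_additive]: a box is
    cut into two slabs for subadditivity, and two slabs at distance [e] inside a longer box give the
    inequality with a gap. Translation invariance identifies each slab with a box at the origin. *)
Lemma box3_coord (R : realType) (a : 'I_3 -> R) i : (forall j, 0 <= a j) ->
  hausdorff3_raw (box3 (fun=> 0%R) a) =
  ((a i)%:E * hausdorff3_raw (box3 (fun=> 0%R) (upd3 a i 1)))%E.
Proof.
move=> a0.
pose F s := hausdorff3_raw (box3 (fun=> 0%R) (upd3 a i s)).
have Ffin s : F s \is a fin_num.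
  by rewrite ge0_fin_numE ?hausdorff3_raw_ge0 ?box3_lty.
pose slab s t := box3 (upd3 (fun=> 0) i s) (upd3 a i t).
have slabE s t : hausdorff3_raw (slab s (s + t)) = F t.
  rewrite box3_translate; congr (hausdorff3_raw (box3 _ _)).
  apply/funext => j; rewrite /upd3; case: ifP => _; last by rewrite subr0.
  by rewrite addrC addKr.
have Fmono s t : s <= t -> (F s <= F t)%E.
  move=> st; apply: hausdorff3_raw_mono => x hx j; have := hx j; rewrite /upd3.
  by case: ifP => // _ /andP[-> /le_trans->].
have -> : a = upd3 a i (a i).
  by apply/funext => j; rewrite /upd3; case: eqP => [->|].
have -> : upd3 (upd3 a i (a i)) i 1 = upd3 a i 1.
  by apply/funext => j; rewrite /upd3; case: (j == i).
have -> : upd3 a i (a i) i = a i by rewrite /upd3 eqxx.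
rewrite -/(F (a i)) -/(F 1) -(fineK (Ffin 1)) -EFinM.
rewrite -(fineK (Ffin (a i))); congr EFin.
apply: (linear_of_gap_additive (f := fun s => fine (F s))) => //.
- by move=> s _; rewrite fine_ge0// hausdorff3_raw_ge0.
- by move=> s t _ st; rewrite fine_le// Fmono.
- move=> s t s0 t0; rewrite -lee_fin EFinD !fineK//.
  rewrite -(slabE s t); apply: le_trans (hausdorff3_raw_setU _ _).
  apply: hausdorff3_raw_mono => x hx.
  have /andP[x0 xst] := hx i; rewrite /upd3 eqxx in xst.
  have [xs|sx] := leP (x ord0 i) s; [left|right] => j; have := hx j;
    rewrite /upd3; case: eqP => // -> /andP[h1 h2]; rewrite ?h1 ?h2 ?xs//.
  by rewrite (ltW sx).
- move=> s t e s0 t0 e0; rewrite -lee_fin EFinD !fineK//.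
  rewrite -(slabE (s + e) t); apply: le_trans (hausdorff3_raw_separated _) _.
    exists e => // x y /(_ i) + /(_ i); rewrite /upd3 eqxx.
    move=> /andP[_ h1] /andP[h2 _].
    apply: le_trans (coord_le_eucl_dist x y i); rewrite distrC.
    by apply: le_trans (ler_norm _); lra.
  apply: hausdorff3_raw_mono => x [] hx j; have := hx j; rewrite /upd3;
    case: eqP => // _ /andP[h1 h2]; apply/andP; split; lra.
Qed.

Lemma hausdorff3_raw_box3 (R : realType) (lo hi : 'I_3 -> R) :
  (forall i, lo i <= hi i) ->
  hausdorff3_raw (box3 lo hi) =
  ((\prod_i (hi i - lo i))%:E * hausdorff3_raw (unit_cube3 R))%E.
Proof.
move=> lohi; rewrite box3_translate; set a := fun i => hi i - lo i.
have a0 i : 0 <= a i by rewrite subr_ge0.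
have upd0 b i : (forall j, 0 <= b j) -> forall j, 0 <= upd3 b i (1 : R) j.
  by move=> b0 j; rewrite /upd3; case: ifP.
pose i1 : 'I_3 := lift ord0 ord0; pose i2 : 'I_3 := lift ord0 (lift ord0 ord0).
rewrite (box3_coord ord0 a0) (box3_coord i1 (upd0 _ _ a0)).
rewrite (box3_coord i2 (upd0 _ _ (upd0 _ _ a0))) !muleA -!EFinM.
rewrite !big_ord_recl big_ord0 mulr1 !mulrA; congr (_ * hausdorff3_raw _)%E.
rewrite unit_cube3E; congr box3; apply/funext => j; rewrite /upd3.
by case: j => [[|[|[|]]]].
Qed.

Lemma hausdorff3_raw_box3_flat (R : realType) (lo hi : 'I_3 -> R) i :
  (forall i, lo i <= hi i) -> lo i = hi i -> hausdorff3_raw (box3 lo hi) = 0%E.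
Proof.
move=> lohi loihi; rewrite hausdorff3_raw_box3// (bigD1 i)//= loihi subrr mul0r.
by rewrite mul0e.
Qed.

(** * Locally unimodular maps preserve the measure *)

Lemma nbhs_rV_coord (R : realType) n (p : 'rV[R]_n) (P : set 'rV[R]_n) :
  nbhs p P ->
  exists2 d : R, 0 < d &
    forall q : 'rV[R]_n, (forall i, `|q ord0 i - p ord0 i| < d) -> P q.
Proof.
move=> /nbhs_ballP[d /= d0 dP]; exists d => // q pq; apply: dP.
by split=> // i j; rewrite ord1 /ball/= distrC.
Qed.

Lemma nbhs_rV_coord_pair (R : realType) n (p : 'rV[R]_n)
    (P : set ('rV[R]_n * 'rV[R]_n)) :
  (\forall z \near (p, p), P z) ->
  exists2 d : R, 0 < d & forall q q' : 'rV[R]_n,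
    (forall i, `|q ord0 i - p ord0 i| < d) ->
    (forall i, `|q' ord0 i - p ord0 i| < d) -> P (q, q').
Proof.
move=> [[A B] [/= /nbhs_rV_coord[a a0 aA] /nbhs_rV_coord[b b0 bB]] AB].
exists (Num.min a b) => [|q q' qp qp']; first by rewrite lt_min a0.
apply: AB; split => /=; [apply: aA|apply: bB] => i.
- by have := qp i; rewrite lt_min => /andP[].
- by have := qp' i; rewrite lt_min => /andP[].
Qed.

Definition wsqdist (R : realType) (l : 'I_3 -> R) (q q' : 'rV[R]_3) : R :=
  \sum_i (l i * (q ord0 i - q' ord0 i)) ^+ 2.

(** Up to the factor [lam], [f] changes distances like the diagonal matrix with entries [l]. Squared
    distances are used so that both sides are sums over coordinates, comparable term by term. *)
Definition distorts_le (R : realType) n (f : 'rV[R]_3 -> 'rV[R]_n)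
    (l : 'I_3 -> R) (lam : R) (z : 'rV[R]_3 * 'rV[R]_3) : Prop :=
  wsqdist l z.1 z.2 <= lam ^+ 2 * eucl_dist (f z.1) (f z.2) ^+ 2 /\
  eucl_dist (f z.1) (f z.2) ^+ 2 <= lam ^+ 2 * wsqdist l z.1 z.2.

(* For a C^1 map this says that the partial derivatives at each point are
   orthogonal, with lengths [l i] whose product is 1. *)
Definition locally_unimodular (R : realType) n (U : set 'rV[R]_3)
    (f : 'rV[R]_3 -> 'rV[R]_n) : Prop :=
  forall p, U p -> exists l : 'I_3 -> R,
    [/\ forall i, 0 < l i, \prod_i l i = 1 &
     forall lam, 1 < lam -> \forall z \near (p, p), distorts_le f l lam z].

Lemma locally_unimodular_id (R : realType) (U : set 'rV[R]_3) :
  locally_unimodular U id.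
Proof.
move=> p _; exists (fun=> 1); split => // [|lam lam1].
  by rewrite big1.
suff h z : distorts_le (@id 'rV[R]_3) (fun=> 1) lam z.
  by exists (setT, setT) => //=; split; exact: filterT.
case: z => q q'; rewrite /distorts_le /wsqdist/= sqr_eucl_dist.
under eq_bigr do rewrite mul1r.
have lam2 : 1 <= lam ^+ 2 by rewrite expr_ge1// ltW// (lt_trans ltr01).
by split; rewrite ler_peMl// sumr_ge0// => i _; rewrite sqr_ge0.
Qed.

Lemma locally_unimodular_continuous (R : realType) n (U : set 'rV[R]_3)
    (f : 'rV[R]_3 -> 'rV[R]_n) p i :
  locally_unimodular U f -> U p -> {for p, continuous (fun q => f q ord0 i)}.
Proof.
move=> uf Up; have [l [l0 _ /(_ 2)]] := uf p Up.
rewrite ltr1n => /(_ isT)/nbhs_rV_coord_pair[d d0 hd].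
(* The summand 1 gives L >= 1, so the sum of the [l i ^+ 2] is at most L^2, and the bound 4 L^2 r^2
   on the squared distance is at most e^2. *)
pose L := 1 + \sum_i l i ^+ 2.
have L1 : 1 <= L by rewrite lerDl sumr_ge0// => j _; rewrite sqr_ge0.
have L0 : 0 < L by apply: lt_le_trans L1.
apply: (iffRL (@cvgrPdist_le _ _ _ (nbhs p) _ _ _)) => e e0.
pose r := Num.min d (e / (2 * L)).
have r0 : 0 < r by rewrite lt_min d0 divr_gt0// mulr_gt0.
have : \forall q \near nbhs p, forall j : 'I_3, `|(q : 'rV[R]_3) ord0 j - p ord0 j| < r.
  apply/nbhs_ballP; exists r => //= q [_ qp] j.
  by have := qp ord0 j; rewrite /ball/= distrC.
apply: filterS => q qp.
have [_ ] : distorts_le f l 2 (p, q).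
  apply: hd => j; first by rewrite subrr normr0.
  by apply: lt_le_trans (qp j) _; rewrite ge_min lexx.
rewrite /= => h.
apply: le_trans (coord_le_eucl_dist (f p) (f q) i) _.
rewrite -(@ler_pXn2r _ 2%N)// ?nnegrE ?eucl_dist_ge0 ?(ltW e0)//.
apply: le_trans h _.
have : wsqdist l p q <= \sum_j l j ^+ 2 * r ^+ 2.
  apply: ler_sum => j _; rewrite exprMn ler_wpM2l ?sqr_ge0//.
  rewrite -(real_normK (num_real _)) ler_pXn2r ?nnegrE ?(ltW r0)//.
  by rewrite distrC ltW.
rewrite -mulr_suml => h1.
have h2 : 2 * L * r <= e.
  rewrite mulrC -ler_pdivlMr ?mulr_gt0// ge_min lexx orbT//.
have h3 : (2 * L * r) ^+ 2 <= e ^+ 2.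
  by rewrite ler_pXn2r ?nnegrE ?(ltW e0)// !mulr_ge0 ?(ltW L0) ?(ltW r0).
apply: le_trans h3; rewrite -natrX !exprMn -natrX.
rewrite -mulrA ler_pM2l; last by rewrite ltr0n.
apply: le_trans h1 _; rewrite ler_wpM2r ?sqr_ge0//.
apply: (@le_trans _ _ L); first by rewrite lerDr.
by rewrite expr2 ler_peMl// ltW.
Qed.

Lemma box3_compact (R : realType) (lo hi : 'I_3 -> R) : compact (box3 lo hi).
Proof.
rewrite (_ : box3 lo hi =
  [set v : 'rV[R]_3 | forall i, `[lo i, hi i]%classic (v ord0 i)]).
  apply: (@rV_compact R 3 (fun i => `[lo i, hi i]%classic)) => i.
  exact: segment_compact.
by apply/seteqP; split => x hx i; have := hx i; rewrite /= in_itv.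
Qed.

(** The squared distance between images is continuous on the compact product, so it attains its
    minimum, which is positive because the images are disjoint. *)
Lemma pos_separated_compact (R : realType) n (f : 'rV[R]_3 -> 'rV[R]_n)
    (K K' : set 'rV[R]_3) :
  compact K -> compact K' ->
  (forall p i, (K `|` K') p -> {for p, continuous (fun q => f q ord0 i)}) ->
  (forall p q, K p -> K' q -> f p <> f q) ->
  pos_separated (f @` K) (f @` K').
Proof.
move=> cK cK' cf fKK'.
have [KK'0|/set0P KK'0] := eqVneq (K `*` K') set0.
  exists 1 => // _ _ [p Kp <-] [q Kq <-].
  by have : (K `*` K') (p, q) by []; rewrite KK'0.
pose h (z : 'rV[R]_3 * 'rV[R]_3) :=
  \sum_(i < n) (f z.1 ord0 i - f z.2 ord0 i) * (f z.1 ord0 i - f z.2 ord0 i).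
have hE z : h z = \sum_(i < n) (f z.1 ord0 i - f z.2 ord0 i) ^+ 2 by [].
have ch : {within K `*` K', continuous h}.
  apply: continuous_in_subspaceT => -[p q] /set_mem [/= Kp Kq].
  apply: (@cvg_big _ _ _ _ _ (@add_continuous R) _ (nbhs (p, q))) => i _.
  have c : {for (p, q), continuous (fun z : 'rV[R]_3 * 'rV[R]_3 =>
      f z.1 ord0 i - f z.2 ord0 i)}.
    apply: cvgB.
    - apply: (cvg_comp _ (fun q => f q ord0 i) (@cvg_fst _ _ _ _ _)).
      by apply: cf; left.
    - apply: (cvg_comp _ (fun q => f q ord0 i) (@cvg_snd _ _ _ _ _)).
      by apply: cf; right.
  exact: (cvgM c c).
have [[p q] /set_mem [/= Kp Kq] hmin] :=
  compact_EVT_min KK'0 (compact_setX cK cK') ch.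
have h0 : 0 < h (p, q).
  rewrite hE lt0r sumr_ge0 ?andbT; last by move=> i _; exact: sqr_ge0.
  rewrite psumr_neq0; last by move=> i _; exact: sqr_ge0.
  apply/negP => hz; apply: (fKK' p q Kp Kq); apply/rowP => i.
  apply/eqP; rewrite -subr_eq0 -sqrf_eq0; apply/negPn/negP => ne.
  apply: hz; apply/hasP; exists i; first by rewrite mem_index_enum.
  by rewrite /= lt0r ne sqr_ge0.
exists (Num.sqrt (h (p, q))); first by rewrite sqrtr_gt0.
move=> _ _ [p' Kp' <-] [q' Kq' <-]; apply: ler_wsqrtr.
by rewrite -(hE (p', q')); apply: hmin; apply/mem_set.
Qed.

(** * Dyadic cells and the comparison of two maps on them *)

Definition dyadic_index (R : realType) (n : nat) (p : 'rV[R]_3) :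
    {ffun 'I_3 -> int} :=
  [ffun i => Num.floor (2 ^+ n * p ord0 i)].

(** [h] is the side in units of 2^-n. For [h = 1] this is the closed dyadic cube; for [h < 1] the
    box lies in the half-open cell of index [k], so boxes from different cells are disjoint compact
    sets. *)
Definition dyadic_box (R : realType) (n : nat) (k : {ffun 'I_3 -> int})
    (h : R) : set 'rV[R]_3 :=
  box3 (fun i => (k i)%:~R / 2 ^+ n) (fun i => ((k i)%:~R + h) / 2 ^+ n).

(** For an integer j, j <= 2^m x holds exactly when j 2^(n-m) <= floor (2^n x), so the index at
    level [n] determines the coarser ones. *)
Lemma dyadic_index_nested (R : realType) m n (p q : 'rV[R]_3) : (m <= n)%N ->
  dyadic_index n p = dyadic_index n q -> dyadic_index m p = dyadic_index m q.
Proof.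
move=> mn /ffunP h; apply/ffunP => i; have := h i; rewrite !ffunE => hi.
apply/esym/floor_def; set z := Num.floor _.
have [e ne] : exists e, n = (m + e)%N by exists (n - m)%N; rewrite subnKC.
have e0 : 0 < 2 ^+ e :> R by rewrite exprn_gt0.
have zE (j : int) : (j%:~R <= 2 ^+ m * q ord0 i) = (j%:~R <= 2 ^+ m * p ord0 i).
  have aux x : (j%:~R <= 2 ^+ m * x) = ((j * 2 ^+ e)%R <= Num.floor (2 ^+ n * x :> R)).
    rewrite floor_ge_int intrM rmorphXn/= ne exprD mulrAC.
    by rewrite ler_pM2r.
  by rewrite !aux hi.
rewrite zE ltNge zE -ltNge -floor_ge_int lexx/=.
by rewrite -floor_lt_int ltzD1 lexx.
Qed.

Lemma dyadic_index_box (R : realType) n (p : 'rV[R]_3) :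
  dyadic_box n (dyadic_index n p) 1 p.
Proof.
have n0 : 0 < 2 ^+ n :> R by rewrite exprn_gt0.
move=> i; rewrite ffunE ler_pdivrMr// ler_pdivlMr// mulrC.
by rewrite -floor_ge_int lexx/= ltW// -natr1 -intrD1 -floor_lt_int ltzD1.
Qed.

Lemma dyadic_box_index (R : realType) n k (h : R) (p : 'rV[R]_3) : h < 1 ->
  dyadic_box n k h p -> dyadic_index n p = k.
Proof.
have n0 : 0 < 2 ^+ n :> R by rewrite exprn_gt0.
move=> h1 kp; apply/ffunP => i; rewrite ffunE; apply: floor_def.
have := kp i; rewrite ler_pdivrMr// ler_pdivlMr// mulrC => /andP[-> h2]/=.
by rewrite (le_lt_trans h2)// intrD ltrD2l.
Qed.

Lemma dyadic_box_near (R : realType) n (p q : 'rV[R]_3) (d : R) :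
  (2 ^+ n)^-1 < d -> dyadic_box n (dyadic_index n p) 1 q ->
  forall i, `|q ord0 i - p ord0 i| < d.
Proof.
move=> nd qb i; apply: le_lt_trans nd.
have := qb i; have := dyadic_index_box n p i.
rewrite !mulrDl mul1r => /andP[h1 h2] /andP[h3 h4].
by rewrite ler_norml; apply/andP; split; lra.
Qed.

Lemma dyadic_box_measure (R : realType) n k (h : R) (l : 'I_3 -> R) : 0 <= h ->
  (forall i, 0 < l i) -> \prod_i l i = 1 ->
  hausdorff3_raw ((fun q : 'rV[R]_3 => \row_i (l i * q ord0 i)) @` dyadic_box n k h) =
  (((h / 2 ^+ n) ^+ 3)%:E * hausdorff3_raw (unit_cube3 R))%E.
Proof.
move=> h0 l0 l1.
have n0 : 0 < 2 ^+ n :> R by rewrite exprn_gt0.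
have -> : (fun q : 'rV[R]_3 => \row_i (l i * q ord0 i)) @` dyadic_box n k h =
  box3 (fun i => l i * ((k i)%:~R / 2 ^+ n))
       (fun i => l i * (((k i)%:~R + h) / 2 ^+ n)).
  apply/seteqP; split => [_ [q hq <-] i|q hq].
    by rewrite !mxE !ler_pM2l.
  exists (\row_i ((l i)^-1 * q ord0 i)).
    by move=> i; rewrite mxE ler_pdivlMl// ler_pdivrMl.
  by apply/rowP => i; rewrite !mxE mulVKf// gt_eqF.
rewrite hausdorff3_raw_box3 => [|i]; last first.
  by rewrite ler_pM2l// ler_pM2r ?invr_gt0// lerDl.
congr (_%:E * _)%E.
rewrite (eq_bigr (fun i => l i * (h / 2 ^+ n))); last first.
  by move=> i _; rewrite -mulrBr -mulrBl addrC addKr.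
by rewrite big_split/= l1 mul1r prodr_const card_ord.
Qed.

Lemma wsqdist_scale (R : realType) (l : 'I_3 -> R) (q q' : 'rV[R]_3) :
  wsqdist l q q' =
  eucl_dist (\row_i (l i * q ord0 i)) (\row_i (l i * q' ord0 i)) ^+ 2.
Proof.
by rewrite sqr_eucl_dist; apply: eq_bigr => i _; rewrite !mxE mulrBr.
Qed.

Lemma le_of_le_mul_powers (R : realType) (x y : \bar R) (n : nat) :
  (0 <= y)%E -> (forall lam : R, 1 < lam -> (x <= (lam ^+ n)%:E * y)%E) ->
  (x <= y)%E.
Proof.
move=> y0 h; have [->|yoo] := eqVneq y +oo%E; first by rewrite leey.
have yfin : y \is a fin_num by rewrite ge0_fin_numE// ltey.
move: y0 h; rewrite -(fineK yfin); set z := fine y; rewrite lee_fin => z0 h.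
(* By convexity (1 + e)^n lies below its chord 1 + (2^n - 1) e on [0, 1]; the induction proves this
   chord bound. *)
have bern (e : R) : 0 <= e -> e <= 1 -> (1 + e) ^+ n <= 1 + 2 ^+ n * e.
  move=> e0 e1; suff : (1 + e) ^+ n <= 1 + (2 ^+ n - 1) * e.
    by move/le_trans; apply; rewrite lerD2l ler_wpM2r// gerBl.
  elim: n {h} => [|m IH]; first by rewrite !expr0 subrr mul0r addr0.
  rewrite exprSr; apply: le_trans (ler_wpM2r _ IH) _; first by rewrite addr_ge0.
  have m1 : 1 <= 2 ^+ m :> R by rewrite exprn_ege1// ler1n.
  have : (2 ^+ m - 1) * e * e <= (2 ^+ m - 1) * e * 1.
    by rewrite ler_wpM2l// mulr_ge0// subr_ge0.
  rewrite exprSr; lra.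
apply/lee_addgt0Pr => e e0.
have n0 : 0 < 2 ^+ n :> R by rewrite exprn_gt0.
have z1 : 0 < z + 1 by rewrite ltr_wpDl.
pose d := Num.min 1 (e / (2 ^+ n * (z + 1))).
have d0 : 0 < d by rewrite lt_min ltr01 divr_gt0// mulr_gt0.
have d1 : d <= 1 by rewrite ge_min lexx.
have dd : d * (2 ^+ n * (z + 1)) <= e.
  by rewrite -ler_pdivlMr ?mulr_gt0// ge_min lexx orbT.
apply: le_trans (h (1 + d) _) _; first by rewrite ltrDl.
rewrite -EFinM -EFinD lee_fin.
apply: le_trans (ler_wpM2r z0 (bern d (ltW d0) d1)) _.
have : 0 <= 2 ^+ n * d by rewrite mulr_ge0// ltW.
lra.
Qed.

Section Comparison.
Context (R : realType) (n m : nat) (U : set 'rV[R]_3).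
Context (f : 'rV[R]_3 -> 'rV[R]_n) (g : 'rV[R]_3 -> 'rV[R]_m) (lam : R).

(** [f] and [g] are controlled on the same closed cube, so that their images can be compared through
    two diagonal maps of determinant 1, possibly different. *)
Let good (j : nat) (k : {ffun 'I_3 -> int}) : Prop :=
  dyadic_box j k 1 `<=` U /\
  exists lf lg : 'I_3 -> R,
    [/\ forall i, 0 < lf i, forall i, 0 < lg i, \prod_i lf i = 1,
        \prod_i lg i = 1 &
        forall q q', dyadic_box j k 1 q -> dyadic_box j k 1 q' ->
          distorts_le f lf lam (q, q') /\ distorts_le g lg lam (q, q')].

(** The coarsest good cell around a point, as in a Whitney decomposition. Coarser indices depend
    only on the index at level [jk.1], so a piece is either empty or a whole half-open cell, and
    distinct pieces are disjoint. *)
Let piece (jk : nat * {ffun 'I_3 -> int}) : set 'rV[R]_3 :=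
  [set p | [/\ dyadic_index jk.1 p = jk.2, good jk.1 jk.2 &
             forall j, (j < jk.1)%N -> ~ good j (dyadic_index j p)]].

Let piece_eq p jk jk' : piece jk p -> piece jk' p -> jk = jk'.
Proof.
case: jk jk' => [j k] [j' k'] /= [/= pk Gk mk] [/= pk' Gk' mk'].
suff jj' : j = j' by rewrite -pk -pk' jj'.
apply/eqP; rewrite eqn_leq; apply/andP; split; rewrite leqNgt; apply/negP.
- by move=> /mk; rewrite pk'.
- by move=> /mk'; rewrite pk.
Qed.

Let cube (jk : nat * {ffun 'I_3 -> int}) := dyadic_box jk.1 jk.2 lam^-1 : set 'rV[R]_3.

Hypothesis lam1 : 1 < lam.

Let lam0 : 0 < lam. Proof. exact: lt_trans lam1. Qed.

Let cube_sub_box jk : cube jk `<=` dyadic_box jk.1 jk.2 1.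
Proof.
move=> p hp i; have /andP[-> h]/= := hp i; apply: le_trans h _.
by rewrite ler_pM2r ?invr_gt0 ?exprn_gt0// lerD2l invf_le1// ltW.
Qed.

(** Since 1 / lam < 1, the shrunk cube avoids the upper faces and stays in the half-open cell; its
    points then share all coarser cells with [p]. *)
Let cube_sub_piece jk p : piece jk p -> cube jk `<=` piece jk.
Proof.
move=> [pk Gk mk] q qk.
have qi : dyadic_index jk.1 q = jk.2.
  by apply: dyadic_box_index qk; rewrite invf_lt1.
split => // j jj; rewrite (@dyadic_index_nested _ j jk.1 q p) ?(ltnW jj) ?pk//.
exact: mk.
Qed.

Let piece_sub jk : piece jk `<=` U.
Proof. by move=> p [<- [+ _] _]; apply; exact: dyadic_index_box. Qed.

(** The exponent 9 is 3 + 3 + 3: the distortion of [g], that of [f], and the ratio of volumes of the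
    full cell and the shrunk cube. The diagonal images of equal cubes have equal measure since both
    determinants are 1. *)
Let piece_measure jk p : piece jk p ->
  (hausdorff3_raw (g @` piece jk) <=
   (lam ^+ 9)%:E * hausdorff3_raw (f @` cube jk))%E.
Proof.
move=> [_ [_ [lf [lg [lf0 lg0 lf1 lg1 dist]]]] _].
pose D (l : 'I_3 -> R) (q : 'rV[R]_3) : 'rV[R]_3 := \row_i (l i * q ord0 i).
set j := jk.1 in dist *; set k := jk.2 in dist *.
have up : (hausdorff3_raw (g @` dyadic_box j k 1) <=
    (lam ^+ 3)%:E * hausdorff3_raw (D lg @` dyadic_box j k 1))%E.
  apply: hausdorff3_raw_lipschitz => // q q' hq hq'.
  rewrite -(@ler_pXn2r _ 2%N) ?nnegrE ?mulr_ge0 ?eucl_dist_ge0 ?(ltW lam0)//.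
  by rewrite exprMn -wsqdist_scale; have [_ []] := dist q q' hq hq'.
have low : (hausdorff3_raw (D lf @` cube jk) <=
    (lam ^+ 3)%:E * hausdorff3_raw (f @` cube jk))%E.
  apply: hausdorff3_raw_lipschitz => // q q' /cube_sub_box hq /cube_sub_box hq'.
  rewrite -(@ler_pXn2r _ 2%N) ?nnegrE ?mulr_ge0 ?eucl_dist_ge0 ?(ltW lam0)//.
  by rewrite exprMn -wsqdist_scale; have [[]] := dist q q' hq hq'.
have sub : g @` piece jk `<=` g @` dyadic_box j k 1.
  apply: image_subset => q [qk _ _].
  by have := dyadic_index_box jk.1 q; rewrite qk.
apply: le_trans (hausdorff3_raw_mono sub) _; apply: le_trans up _.
rewrite (dyadic_box_measure _ _ ler01 lg0 lg1).
rewrite (dyadic_box_measure _ _ _ lf0 lf1) in low; last first.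
  by rewrite invr_ge0 ltW.
have -> : ((lam ^+ 3)%:E * (((1 / 2 ^+ j) ^+ 3)%:E * hausdorff3_raw (unit_cube3 R)) =
    (lam ^+ 6)%:E * (((lam^-1 / 2 ^+ j) ^+ 3)%:E * hausdorff3_raw (unit_cube3 R)))%E.
  rewrite !muleA -!EFinM; congr (_%:E * _)%E.
  have : 2 ^+ j != 0 :> R by rewrite expf_neq0.
  set X := 2 ^+ j => X0; have lamN0 : lam != 0 by rewrite gt_eqF.
  by field; rewrite X0 lamN0.
have -> : ((lam ^+ 9)%:E = (lam ^+ 6)%:E * (lam ^+ 3)%:E)%E.
  by rewrite -EFinM -exprD.
by rewrite -muleA lee_pmul2l// lte_fin exprn_gt0.
Qed.

Hypothesis openU : open U.
Hypothesis uf : locally_unimodular U f.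
Hypothesis ug : locally_unimodular U g.
Hypothesis injf : forall p q, U p -> U q -> f p = f q -> p = q.

(** Openness of [U] and the local bounds at [p] make every sufficiently fine cell around [p] good;
    the smallest good level then gives the piece. *)
Let piece_cover p : U p -> exists jk, piece jk p.
Proof.
move=> Up.
suff ex : exists j, `[< good j (dyadic_index j p) >].
  case: (ex_minnP ex) => j /asboolP Gj' jmin.
  exists (j, dyadic_index j p); split => //= i ij Gi.
  by have := jmin i (asboolT Gi); rewrite leqNgt ij.
have [a a0 aU] := nbhs_rV_coord (open_nbhs_nbhs (conj openU Up)).
have [lf [lf0 lf1 /(_ lam lam1)/nbhs_rV_coord_pair[b b0 hb]]] := uf Up.
have [lg [lg0 lg1 /(_ lam lam1)/nbhs_rV_coord_pair[c c0 hc]]] := ug Up.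
pose d := Num.min a (Num.min b c).
have d0 : 0 < d by rewrite !lt_min a0 b0.
pose j := (Num.truncn (d^-1)).+1.
have jd : (2 ^+ j)^-1 < d.
  rewrite invf_plt ?posrE ?exprn_gt0//; apply: lt_trans (truncnS_gt _) _.
  by rewrite -natrX ltr_nat ltn_expl.
exists j; apply/asboolP.
have near q : dyadic_box j (dyadic_index j p) 1 q -> forall i,
    [/\ `|q ord0 i - p ord0 i| < a, `|q ord0 i - p ord0 i| < b &
     `|q ord0 i - p ord0 i| < c].
  move=> hq i; have := dyadic_box_near jd hq i; rewrite !lt_min.
  by move=> /and3P[].
split=> [q hq|]; first by apply: aU => i; have [] := near q hq i.
exists lf, lg; split => // q q' hq hq'; split.
- by apply: hb => i; [have [] := near q hq i|have [] := near q' hq' i].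
- by apply: hc => i; [have [] := near q hq i|have [] := near q' hq' i].
Qed.

(** The pieces [V] cover [U] and bound the image under [g] from above. Each contains a compact cube
    [B]; by injectivity and continuity the images of these cubes under [f] are positively separated,
    so every partial sum of their measures is at most the measure of the image of [U]. *)
Lemma locally_unimodular_le_power :
  (hausdorff3_raw (g @` U) <= (lam ^+ 9)%:E * hausdorff3_raw (f @` U))%E.
Proof.
pose V (i : nat) : set 'rV[R]_3 :=
  if pickle_inv i is Some jk then piece jk else set0.
(* For an empty piece the cube need not lie in [U], hence the test. *)
pose B (i : nat) : set 'rV[R]_3 :=
  if pickle_inv i is Some jk then
    if `[< piece jk !=set0 >] then cube jk else set0
  else set0.
have BV i : B i `<=` V i.
  rewrite /B /V; case: pickle_inv => // jk; case: asboolP => // -[p hp].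
  exact: cube_sub_piece hp.
have VU i : V i `<=` U.
  by rewrite /V; case: pickle_inv => // jk; exact: piece_sub.
have Vmeas i : (hausdorff3_raw (g @` V i) <=
    (lam ^+ 9)%:E * hausdorff3_raw (f @` B i))%E.
  rewrite /V /B; case: pickle_inv => [jk|]; last first.
    by rewrite !image_set0 !hausdorff3_raw_set0 mule0.
  case: asboolP => [[p hp]|]; first exact: piece_measure hp.
  move=> /set0P/negP/negPn/eqP ->.
  by rewrite !image_set0 !hausdorff3_raw_set0 mule0.
have UV : U `<=` \bigcup_i V i.
  move=> p /piece_cover[jk pjk]; exists (pickle jk) => //.
  by rewrite /V pickleK_inv.
have Vdisj i i' p : V i p -> V i' p -> i = i'.
  rewrite /V; have := @pickle_invK (nat * {ffun 'I_3 -> int})%type i.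
  have := @pickle_invK (nat * {ffun 'I_3 -> int})%type i'.
  case: (pickle_inv i) => [jk|//]; case: (pickle_inv i') => [jk'|//] /=.
  by move=> <- <- h /(piece_eq h) ->.
have Bcompact i : compact (B i).
  rewrite /B; case: pickle_inv => [jk|]; last exact: compact0.
  by case: ifP => _; [exact: box3_compact|exact: compact0].
have sub : g @` U `<=` \bigcup_i (g @` V i).
  by move=> _ [p /UV[i _ Vp] <-]; exists i => //; exists p.
apply: le_trans (hausdorff3_raw_mono sub) _.
apply: le_trans (hausdorff3_raw_subadd _) _.
apply: (@le_trans _ _ (\sum_(0 <= i <oo)
    ((lam ^+ 9)%:E * hausdorff3_raw (f @` B i)))%E).
  by apply: lee_nneseries => [i _ _|i _]; first exact: hausdorff3_raw_ge0.
rewrite nneseriesZl; last by move=> i _; exact: hausdorff3_raw_ge0.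
rewrite lee_pmul2l ?lte_fin ?exprn_gt0//.
apply: lime_le.
  by apply: is_cvg_nneseries => i _ _; exact: hausdorff3_raw_ge0.
apply: nearW => N; rewrite big_mkord.
apply: le_trans (@hausdorff3_raw_separated_sum _ _ (fun i => f @` B i) _ _) _.
  move=> i i' ii'; apply: pos_separated_compact => //.
  - move=> p k pB; apply: (@locally_unimodular_continuous _ _ U f p k uf).
    by case: pB => /BV/VU.
  - move=> p q Bp Bq fpq; apply: ii'.
    have := injf (VU i _ (BV _ _ Bp)) (VU i' _ (BV _ _ Bq)) fpq => pq.
    by apply: (Vdisj _ _ p); [exact: BV|rewrite pq; exact: BV].
apply: hausdorff3_raw_mono => _ [i _ [p Bp <-]]; exists p => //.
exact: VU (BV _ _ Bp).
Qed.

End Comparison.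

Lemma locally_unimodular_image (R : realType) n (U : set 'rV[R]_3)
    (f : 'rV[R]_3 -> 'rV[R]_n) :
  open U -> locally_unimodular U f ->
  (forall p q, U p -> U q -> f p = f q -> p = q) ->
  hausdorff3_raw (f @` U) = hausdorff3_raw U.
Proof.
move=> oU uf injf; rewrite -[in RHS](image_id U).
apply/eqP; rewrite eq_le; apply/andP; split;
  apply: (@le_of_le_mul_powers _ _ _ 9) => [|lam lam1];
  rewrite ?hausdorff3_raw_ge0//;
  by apply: locally_unimodular_le_power => //; exact: locally_unimodular_id.
Qed.

(** Differentiability in the form of divided differences: an exact formula for squared distances,
    with coefficients that tend to [l i ^+ 2] on the diagonal, replaces partial derivatives and the
    mean value theorem. *)
Lemma locally_unimodular_at (R : realType) n (f : 'rV[R]_3 -> 'rV[R]_n)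
    (p : 'rV[R]_3) (l : 'I_3 -> R) (c : 'I_3 -> 'rV[R]_3 * 'rV[R]_3 -> R) :
  (forall i, 0 < l i) ->
  (forall i, c i z @[z --> (p, p)] --> l i ^+ 2) ->
  (\forall z \near (p, p), eucl_dist (f z.1) (f z.2) ^+ 2 =
     \sum_i c i z * (z.1 ord0 i - z.2 ord0 i) ^+ 2) ->
  forall lam, 1 < lam -> \forall z \near (p, p), distorts_le f l lam z.
Proof.
move=> l0 cl fE lam lam1.
have lam2 : 1 < lam ^+ 2 by rewrite exprn_egt1.
have lam20 : 0 < lam ^+ 2 by apply: lt_trans lam2.
have cn : \forall z \near nbhs (p, p),
    forall i, l i ^+ 2 <= lam ^+ 2 * c i z /\ c i z <= lam ^+ 2 * l i ^+ 2.
  apply: filter_forall => i.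
  have li2 : 0 < l i ^+ 2 by rewrite exprn_gt0.
  have h1 : \forall z \near nbhs (p, p), c i z < lam ^+ 2 * l i ^+ 2.
    by apply: cvgr_lt (cl i) _ _; rewrite ltr_pMl.
  have h2 : \forall z \near nbhs (p, p), l i ^+ 2 / lam ^+ 2 < c i z.
    by apply: cvgr_gt (cl i) _ _; rewrite ltr_pdivrMr// ltr_pMr.
  apply: (@filterS2 _ (nbhs (p, p)) _ _ _ _ _ h1 h2) => z z1 z2.
  by split; [rewrite mulrC -ler_pdivrMr// ltW|exact: ltW].
apply: (@filterS2 _ (nbhs (p, p)) _ _ _ _ _ fE cn) => -[q q'] /= E h.
rewrite /distorts_le /= E /wsqdist !mulr_sumr.
split; apply: ler_sum => i _; have [h1 h2] := h i;
  rewrite exprMn; set D := (q ord0 i - q' ord0 i) ^+ 2;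
  have D0 : 0 <= D by exact: sqr_ge0.
- by rewrite [leRHS]mulrA; exact: ler_wpM2r.
- by rewrite [leRHS]mulrA; exact: ler_wpM2r.
Qed.

(** * Polar coordinates on the cone *)

(** The value 1 at 0 makes [sinc] continuous there and lets 2 (1 - cos x) = (2 sin (x/2))^2 be
    written as a multiple of x^2 for every x. *)
Definition sinc (R : realType) (x : R) : R := if x == 0 then 1 else sin x / x.

Lemma sinc_continuous0 (R : realType) : {for (0 : R), continuous (@sinc R)}.
Proof.
apply/continuous_withinNx; rewrite /sinc eqxx.
have : h^-1 *: ((sin \o shift 0) (h *: 1) - sin 0) @[h --> (0 : R)^'] --> (1 : R).
  rewrite -[X in _ --> X]cos0 -(derive_val (is_derive := is_derive_sin (0 : R))).
  by have := @ex_derive _ _ _ _ _ _ _ (is_derive_sin (0 : R)).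
apply: cvg_trans; apply: near_eq_cvg.
near=> x; have x0 : x != 0 by near: x; exact: nbhs_dnbhs_neq.
by rewrite /= (negbTE x0) addr0 sin0 subr0 [x *: 1]mulr1 [RHS]mulrC.
Unshelve. all: by end_near. Qed.

Lemma sinc_half (R : realType) (x : R) :
  2 * (1 - cos x) = sinc (x / 2) ^+ 2 * x ^+ 2.
Proof.
rewrite /sinc; case: eqP => [x0|/eqP xN0].
  have -> : x = 0 by rewrite -[x](divfK (_ : 2 != 0 :> R)) ?x0 ?mul0r ?pnatr_eq0.
  by rewrite cos0 subrr mulr0 expr0n mulr0.
have -> : cos x = cos ((x / 2) *+ 2) by rewrite -mulr_natr divfK ?pnatr_eq0.
rewrite cos_mulr2n cos2sin2; set s := sin _.
have xN : x != 0 by apply: contra xN0 => /eqP ->; rewrite mul0r.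
by field.
Qed.

(** On positive reals, the inverse of R |-> R^3 / 3: it recovers the scaled radius from z. *)
Definition cube_root3 (R : realType) (z : R) : R := expR (ln (3 * z) / 3).

Lemma cube_root3_gt0 (R : realType) (z : R) : 0 < cube_root3 z.
Proof. exact: expR_gt0. Qed.

Lemma cube_root3K (R : realType) (z : R) : 0 < z -> cube_root3 z ^+ 3 = 3 * z.
Proof.
move=> z0; rewrite /cube_root3 -expRM_natr divfK ?pnatr_eq0//.
by rewrite lnK// posrE mulr_gt0.
Qed.

Lemma cube_root3_continuous (R : realType) (z : R) :
  0 < z -> {for z, continuous (@cube_root3 R)}.
Proof.
move=> z0; apply: continuous_comp; last exact: continuous_expR.
apply: cvgMl.
apply: (@cvg_comp _ _ _ (fun z => 3 * z) (@ln R) _ (nbhs (3 * z))).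
  exact: cvgMr.
by apply: continuous_ln; rewrite mulr_gt0.
Qed.

Lemma sum_pow2 (R : realType) K : \sum_(l < K) 2 ^+ l = 2 ^+ K - 1 :> R.
Proof.
elim: K => [|K IH]; first by rewrite big_ord0 subrr.
by rewrite big_ord_recr/= IH exprS; ring.
Qed.

Lemma binary_sum (m K : nat) : (m < 2 ^ K)%N ->
  (\sum_(l < K) odd (m %/ 2 ^ l) * 2 ^ l)%N = m.
Proof.
elim: K m => [|K IH] m mK; first by rewrite big_ord0; case: m mK.
rewrite big_ord_recl expn0 divn1 muln1.
rewrite (eq_bigr (fun l : 'I_K => 2 * (odd (m./2 %/ 2 ^ l) * 2 ^ l))%N); last first.
  move=> l _; rewrite !lift0 expnS -divn2 divnMA.
  by rewrite mulnCA.
rewrite -big_distrr/= IH; first by rewrite mul2n odd_double_half.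
by rewrite ltn_half_double -mul2n -expnS.
Qed.

(** Every choice of signs is thus coded by a number below 2^K, whose binary digits index the
    sheets. *)
Lemma binary_digits (K : nat) (b : nat -> bool) :
  let m := (\sum_(l < K) b l * 2 ^ l)%N in
  (m < 2 ^ K)%N /\ forall l, (l < K)%N -> odd (m %/ 2 ^ l) = b l.
Proof.
elim: K b => [|K IH] b /=; first by rewrite big_ord0; split.
have [/= h1 h2] := IH (fun l => b l.+1).
rewrite big_ord_recl expn0 muln1.
set m' := (\sum_(l < K) b l.+1 * 2 ^ l)%N in h1 h2.
have -> : (\sum_(i < K) b (lift ord0 i) * 2 ^ lift ord0 i)%N = m'.*2.
  rewrite -mul2n big_distrr/=; apply: eq_bigr => l _.
  by rewrite /bump/= add1n expnS mulnCA.
split.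
  rewrite expnS mul2n; case: (b 0%N); rewrite ?add0n ?ltn_double//.
  by rewrite add1n ltn_Sdouble.
case=> [|l] lK; first by rewrite divn1 oddD odd_double addbF; case: (b 0%N).
rewrite expnS divnMA divn2.
have -> : (b 0%N + m'.*2)./2 = m' by rewrite half_bit_double.
exact: h2.
Qed.

(** * The sheets and their parametrization *)

Definition par_z (R : realType) (p : 'rV[R]_3) : R := p ord0 ord0.
Definition par_v (R : realType) (p : 'rV[R]_3) : R := p ord0 (lift ord0 ord0).
Definition par_phi (R : realType) (p : 'rV[R]_3) : R :=
  p ord0 (lift ord0 (lift ord0 ord0)).

(** The equation of x_4 is the case [l = 0] of a single family over the base R^3, so the cone of
    parameter k is the case K = k + 1, while K = 0 gives R^3 itself. *)
Definition cone (R : realType) (K : nat) : set 'rV[R]_K.+3 :=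
  [set x | forall l, (l < K)%N -> xcoord x l.+4 ^+ 2 =
     2 ^+ l * (xcoord x 1 ^+ 2 + xcoord x 2 ^+ 2 + xcoord x 3 ^+ 2)].
Arguments cone : clear implicits.

Definition digit_sign (R : realType) (m l : nat) : R :=
  if odd (m %/ 2 ^ l) then 1 else -1.
Arguments digit_sign : clear implicits.

(** On sheet [m] the signs satisfy sum_l eps_l 2^l = 2 m + 1 - N; this solves N v = t + 2 m + 1 - N
    for t. *)
Definition sheet_t (R : realType) (K m : nat) (v : R) : R :=
  2 ^+ K * v + 2 ^+ K - 2 * m%:R - 1.

(** For -1 <= v < 1, the only [m] for which t falls in the half-open interval [-1, 1). *)
Definition sheet_of (R : realType) (K : nat) (v : R) : nat :=
  Num.truncn ((2 ^+ K * v + 2 ^+ K) / 2).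

Definition sheet_rho (R : realType) (K : nat) (z : R) : R :=
  cube_root3 z / Num.sqrt (2 ^+ K).

Definition polar_entry (R : realType) (K m : nat) (p : 'rV[R]_3) (j : nat) : R :=
  let t := sheet_t K m (par_v p) in
  sheet_rho K (par_z p) *
  match j with
  | 0 => t
  | 1 => Num.sqrt (1 - t ^+ 2) * cos (par_phi p)
  | 2 => Num.sqrt (1 - t ^+ 2) * sin (par_phi p)
  | l.+3 => digit_sign R m l * Num.sqrt (2 ^+ l)
  end.

Definition polar_sheet (R : realType) (K m : nat) (p : 'rV[R]_3) : 'rV[R]_K.+3 :=
  \row_(j < K.+3) polar_entry K m p j.

Definition polar (R : realType) (K : nat) (p : 'rV[R]_3) : 'rV[R]_K.+3 :=
  polar_sheet K (sheet_of K (par_v p)) p.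

(** The point over (a, 0, 0) on the sheet with all signs positive (for a >= 0); every centre is
    moved to such a point by an isometry of the cone. *)
Definition cone_axis (R : realType) (K : nat) (a : R) : 'rV[R]_K.+3 :=
  \row_(j < K.+3) (a * match (j : nat) with
                       | 0 => 1
                       | 1 | 2 => 0
                       | l.+3 => Num.sqrt (2 ^+ l)
                       end).

Lemma xcoordE (R : realType) n (x : 'rV[R]_n.+1) (j : 'I_n.+1) :
  x ord0 j = xcoord x j.+1.
Proof. by rewrite /xcoord inord_val. Qed.

Lemma xcoord_row (R : realType) n (f : nat -> R) j : (j <= n)%N ->
  xcoord (\row_(i < n.+1) f i) j.+1 = f j.
Proof. by move=> jn; rewrite /xcoord mxE inordK. Qed.

Lemma big_ord_recl3 (R : realType) K (F : nat -> R) :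
  \sum_(i < K.+3) F i = F 0%N + F 1%N + F 2 + \sum_(l < K) F l.+3.
Proof.
by rewrite !big_ord_recl /= !addrA.
Qed.

Lemma digit_sign_sqr (R : realType) m l : digit_sign R m l ^+ 2 = 1.
Proof. by rewrite /digit_sign; case: ifP; rewrite ?sqrrN expr1n. Qed.

Lemma sum_digit_sign (R : realType) m K : (m < 2 ^ K)%N ->
  \sum_(l < K) 2 ^+ l * digit_sign R m l = 2 * m%:R + 1 - 2 ^+ K.
Proof.
move=> mK; rewrite -{2}(binary_sum mK) natr_sum mulr_sumr.
have -> : 2 ^+ K = \sum_(l < K) 2 ^+ l + 1 :> R by rewrite sum_pow2 subrK.
rewrite opprD addrACA subrr addr0 -sumrB; apply: eq_bigr => l _.
rewrite /digit_sign natrM natrX; case: odd; rewrite /=; ring.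
Qed.

Lemma sqr_sqrt_pow2 (R : realType) l : Num.sqrt (2 ^+ l) ^+ 2 = 2 ^+ l :> R.
Proof. by rewrite sqr_sqrtr// exprn_ge0. Qed.

Lemma sqrt_pow2_gt0 (R : realType) l : 0 < Num.sqrt (2 ^+ l) :> R.
Proof. by rewrite sqrtr_gt0 exprn_gt0. Qed.

Lemma sheet_rho_gt0 (R : realType) K (z : R) : 0 < sheet_rho K z.
Proof. by rewrite divr_gt0 ?cube_root3_gt0 ?sqrt_pow2_gt0. Qed.

(** Coordinate l + 3 contributes 2^l (r - r')^2, in all (N - 1) (r - r')^2; the base contributes one
    more (r - r')^2 and r r' times the squared chord on the unit sphere. *)
Lemma polar_sheet_dist (R : realType) K m (p q : 'rV[R]_3) :
  let t := sheet_t K m (par_v p) in let t' := sheet_t K m (par_v q) in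
  let s := Num.sqrt (1 - t ^+ 2) in let s' := Num.sqrt (1 - t' ^+ 2) in
  let r := sheet_rho K (par_z p) in let r' := sheet_rho K (par_z q) in
  0 <= 1 - t ^+ 2 -> 0 <= 1 - t' ^+ 2 ->
  eucl_dist (polar_sheet K m p) (polar_sheet K m q) ^+ 2 =
  2 ^+ K * (r - r') ^+ 2 + r * r' * ((t - t') ^+ 2 + (s - s') ^+ 2 +
    2 * s * s' * (1 - cos (par_phi p - par_phi q))).
Proof.
move=> t t' s s' r r' ht ht'; rewrite sqr_eucl_dist.
under eq_bigr do rewrite !mxE.
rewrite (big_ord_recl3 K (fun j => (polar_entry K m p j - polar_entry K m q j) ^+ 2)).
rewrite /polar_entry /= -/t -/t' -/s -/s' -/r -/r'.
rewrite (eq_bigr (fun l : 'I_K => (r - r') ^+ 2 * 2 ^+ l)); last first.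
  move=> l _; rewrite -mulrBl !exprMn digit_sign_sqr sqr_sqrt_pow2 mul1r.
  by rewrite mulrC.
rewrite -mulr_sumr sum_pow2 cosB.
have hs : s ^+ 2 = 1 - t ^+ 2 by rewrite sqr_sqrtr.
have hs' : s' ^+ 2 = 1 - t' ^+ 2 by rewrite sqr_sqrtr.
have h1 := cos2Dsin2 (par_phi p); have h2 := cos2Dsin2 (par_phi q).
set c := cos (par_phi p) in h1 *; set d := sin (par_phi p) in h1 *.
set c' := cos (par_phi q) in h2 *; set d' := sin (par_phi q) in h2 *.
have e : r ^+ 2 * (t ^+ 2 + s ^+ 2 * (c ^+ 2 + d ^+ 2)) = r ^+ 2.
  by rewrite h1 mulr1 hs addrC subrK mulr1.
have e' : r' ^+ 2 * (t' ^+ 2 + s' ^+ 2 * (c' ^+ 2 + d' ^+ 2)) = r' ^+ 2.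
  by rewrite h2 mulr1 hs' addrC subrK mulr1.
have -> : (r * t - r' * t') ^+ 2 + (r * (s * c) - r' * (s' * c')) ^+ 2 +
  (r * (s * d) - r' * (s' * d')) ^+ 2 =
  r ^+ 2 * (t ^+ 2 + s ^+ 2 * (c ^+ 2 + d ^+ 2)) +
  r' ^+ 2 * (t' ^+ 2 + s' ^+ 2 * (c' ^+ 2 + d' ^+ 2)) -
  2 * r * r' * (t * t' + s * s' * (c * c' + d * d')) by ring.
rewrite e e'.
have -> : (t - t') ^+ 2 + (s - s') ^+ 2 = 2 - 2 * t * t' - 2 * s * s'.
  have -> : (t - t') ^+ 2 + (s - s') ^+ 2 =
    t ^+ 2 + s ^+ 2 + (t' ^+ 2 + s' ^+ 2) - 2 * t * t' - 2 * s * s' by ring.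
  by rewrite hs hs'; ring.
ring.
Qed.

(** In the scalar product with the axis point, the base contributes rho a t and coordinate l + 3
    contributes rho a eps_l 2^l, in all rho a N v = R A v; the squared norms are N rho^2 = R^2 and N
    a^2 = A^2. *)
Lemma polar_sheet_axis_dist (R : realType) K m (p : 'rV[R]_3) (a : R) :
  let r := cube_root3 (par_z p) in let A := Num.sqrt (2 ^+ K) * a in
  (m < 2 ^ K)%N -> 0 <= 1 - sheet_t K m (par_v p) ^+ 2 ->
  eucl_dist (polar_sheet K m p) (cone_axis K a) ^+ 2 =
  r ^+ 2 + A ^+ 2 - 2 * r * A * par_v p.
Proof.
move=> r A mK; set t := sheet_t _ _ _ => ht; rewrite sqr_eucl_dist.
under eq_bigr do rewrite !mxE.
rewrite (big_ord_recl3 K (fun j => (polar_entry K m p j - a * match j with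
  | 0 => 1 | 1 | 2 => 0 | l.+3 => Num.sqrt (2 ^+ l) end) ^+ 2)).
rewrite /polar_entry /= -/t; set s := Num.sqrt (1 - t ^+ 2).
have hs : s ^+ 2 = 1 - t ^+ 2 by rewrite sqr_sqrtr.
rewrite (eq_bigr (fun l : 'I_K => (sheet_rho K (par_z p) ^+ 2 + a ^+ 2) * 2 ^+ l -
  2 * sheet_rho K (par_z p) * a * (2 ^+ l * digit_sign R m l))); last first.
  move=> l _; have h := digit_sign_sqr R m l; have h' := sqr_sqrt_pow2 R l.
  set y := Num.sqrt (2 ^+ l) in h' *; rewrite -h'.
  set x := digit_sign _ _ _ in h *.
  have -> : (sheet_rho K (par_z p) ^+ 2 + a ^+ 2) * y ^+ 2 =
    (sheet_rho K (par_z p) ^+ 2 * x ^+ 2 + a ^+ 2) * y ^+ 2 by rewrite h mulr1.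
  ring.
rewrite sumrB -!mulr_sumr sum_pow2 sum_digit_sign//.
rewrite /sheet_rho -/r {}/A; set N := Num.sqrt (2 ^+ K).
have N0 : N != 0 by rewrite gt_eqF// sqrt_pow2_gt0.
have hN : 2 ^+ K = N ^+ 2 by rewrite sqr_sqrt_pow2.
have ht' : t = N ^+ 2 * par_v p + N ^+ 2 - 2 * m%:R - 1 by rewrite -hN.
rewrite hN !mulr0 !subr0.
have h1 := cos2Dsin2 (par_phi p).
set c := cos _ in h1 *; set d := sin _ in h1 *.
have e : (r / N * (s * c)) ^+ 2 + (r / N * (s * d)) ^+ 2 = (r / N) ^+ 2 * (1 - t ^+ 2).
  by rewrite -hs -[s ^+ 2]mulr1 -h1; ring.
rewrite -addrA -(addrA ((r / N * t - a * 1) ^+ 2)).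
rewrite [X in _ + X](_ : _ = (r / N) ^+ 2 * (1 - t ^+ 2) +
  ((r / N) ^+ 2 + a ^+ 2) * (N ^+ 2 - 1) -
  2 * (r / N) * a * (2 * m%:R + 1 - N ^+ 2)); last first.
  by rewrite -e; ring.
by rewrite ht'; field.
Qed.

Lemma polar_sheet_cone (R : realType) K m (p : 'rV[R]_3) :
  0 <= 1 - sheet_t K m (par_v p) ^+ 2 -> cone R K (polar_sheet K m p).
Proof.
move=> ht l lK; rewrite !(xcoord_row (polar_entry K m p))//.
rewrite /polar_entry /=; set t := sheet_t _ _ _ in ht *.
rewrite !exprMn digit_sign_sqr sqr_sqrt_pow2 sqr_sqrtr// mul1r.
by rewrite -!mulrDr -addrA -mulrDr cos2Dsin2; ring.
Qed.

Lemma sheet_of_lt (R : realType) K (v : R) : v < 1 -> (sheet_of K v < 2 ^ K)%N.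
Proof.
move=> v1; have K0 : 0 < 2 ^+ K :> R by rewrite exprn_gt0.
(* A negative argument, for v < -1, is sent to 0 by [truncn]. *)
have [v0|v0] := leP 0 ((2 ^+ K * v + 2 ^+ K) / 2); last first.
  rewrite /sheet_of truncn_floor leNgt v0/= expn_gt0//.
rewrite /sheet_of truncn_lt_nat// natrX ltr_pdivrMr// mulr_natr mulr2n ltrD2r.
by rewrite gtr_pMr.
Qed.

Lemma sheet_t_bounds (R : realType) K (v : R) : -1 < v ->
  -1 <= sheet_t K (sheet_of K v) v < 1.
Proof.
move=> v1; have K0 : 0 < 2 ^+ K :> R by rewrite exprn_gt0.
have v0 : 0 <= (2 ^+ K * v + 2 ^+ K) / 2.
  rewrite divr_ge0// -[X in _ + X]mulr1 -mulrDr mulr_ge0 ?(ltW K0)//.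
  by rewrite ltW// -ltrBlDr sub0r.
have := truncn_itv v0; rewrite -/(sheet_of K v) /sheet_t.
have -> : (sheet_of K v).+1%:R = (sheet_of K v)%:R + 1 :> R by rewrite natr1.
by move=> /andP[h1 h2]; apply/andP; split; lra.
Qed.

Lemma sheet_of_def (R : realType) K m (v : R) :
  -1 <= sheet_t K m v < 1 -> sheet_of K v = m.
Proof.
rewrite /sheet_t => /andP[h1 h2]; apply: truncn_def.
have -> : m.+1%:R = m%:R + 1 :> R by rewrite natr1.
by apply/andP; split; lra.
Qed.

(** The last condition is the squared distance to the centre in terms of R and v, so the region sees
    the cone only through A. Strict bounds keep it open and the longitude unique. *)
Definition param_region (R : realType) (A r : R) : set 'rV[R]_3 :=
  [set p | [/\ 0 < par_z p, -1 < par_v p < 1, - pi < par_phi p < pi &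
    cube_root3 (par_z p) ^+ 2 + A ^+ 2 -
      2 * cube_root3 (par_z p) * A * par_v p < r ^+ 2]].

(** Removes the walls t = -1, where the sheet index jumps and sqrt(1 - t^2), a factor of the partial
    derivatives, vanishes. *)
Definition sheet_interior (R : realType) (K : nat) : set 'rV[R]_3 :=
  [set p | -1 < sheet_t K (sheet_of K (par_v p)) (par_v p)].
Arguments sheet_interior : clear implicits.

(* [nbhs] at a matrix or at a pair unfolds too eagerly for the filter instances
   of the library lemmas to be found; these specializations avoid that. *)
Lemma cvg_at_M (R : realType) (T : topologicalType) (x : T) (f g : T -> R)
    (a b : R) :
  f z @[z --> x] --> a -> g z @[z --> x] --> b ->
  f z * g z @[z --> x] --> a * b.
Proof. exact: cvgM. Qed.

Lemma cvg_at_D (R : realType) (T : topologicalType) (x : T) (f g : T -> R)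
    (a b : R) :
  f z @[z --> x] --> a -> g z @[z --> x] --> b ->
  f z + g z @[z --> x] --> a + b.
Proof. exact: cvgD. Qed.

Lemma cvg_at_B (R : realType) (T : topologicalType) (x : T) (f g : T -> R)
    (a b : R) :
  f z @[z --> x] --> a -> g z @[z --> x] --> b ->
  f z - g z @[z --> x] --> a - b.
Proof. exact: cvgB. Qed.

Lemma cvg_at_V (R : realType) (T : topologicalType) (x : T) (f : T -> R)
    (a : R) :
  a != 0 -> f z @[z --> x] --> a -> (f z)^-1 @[z --> x] --> a^-1.
Proof. exact: cvgV. Qed.

Lemma cvg_at_cst (R : realType) (T : topologicalType) (x : T) (a : R) :
  a @[z --> x] --> a.
Proof. exact: cvg_cst. Qed.

Lemma cvg_at_comp (R : realType) (T : topologicalType) (x : T) (f : T -> R)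
    (g : R -> R) (a : R) :
  f z @[z --> x] --> a -> {for a, continuous g} ->
  g (f z) @[z --> x] --> g a.
Proof. by move=> fa ga; apply: (cvg_comp _ _ fa). Qed.

Lemma cvg_at_gt (R : realType) (T : topologicalType) (x : T) (f : T -> R)
    (a b : R) :
  f z @[z --> x] --> a -> b < a -> \forall z \near x, b < f z.
Proof. by move=> fa ba; apply: cvgr_gt fa _ ba. Qed.

Lemma cvg_at_lt (R : realType) (T : topologicalType) (x : T) (f : T -> R)
    (a b : R) :
  f z @[z --> x] --> a -> a < b -> \forall z \near x, f z < b.
Proof. by move=> fa ba; apply: cvgr_lt fa _ ba. Qed.

Lemma coord_cvg (R : realType) (p : 'rV[R]_3) i :
  (q : 'rV[R]_3) ord0 i @[q --> p] --> p ord0 i.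
Proof. exact: coord_continuous. Qed.

Lemma sheet_t_cvg (R : realType) K m (p : 'rV[R]_3) :
  sheet_t K m (par_v q) @[q --> p] --> sheet_t K m (par_v p).
Proof.
apply: cvg_at_B; last exact: cvg_at_cst.
apply: cvg_at_B; last exact: cvg_at_cst.
apply: cvg_at_D; last exact: cvg_at_cst.
apply: cvg_at_M; first exact: cvg_at_cst.
exact: coord_cvg.
Qed.

Lemma near_sheet (R : realType) K (p : 'rV[R]_3) :
  -1 < par_v p -> sheet_interior R K p ->
  \forall q \near nbhs p,
    [/\ sheet_of K (par_v q) = sheet_of K (par_v p) &
        -1 < sheet_t K (sheet_of K (par_v p)) (par_v q) < 1].
Proof.
move=> v1 hp; have /andP[_ h1] := sheet_t_bounds K v1.
have c := @sheet_t_cvg R K (sheet_of K (par_v p)) p.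
have n1 := cvg_at_lt c h1; have n2 := cvg_at_gt c hp.
apply: (@filterS2 _ (nbhs p) _ _ _ _ _ n1 n2) => q q1 q2; split.
  by apply: sheet_of_def; rewrite (ltW q2).
by rewrite q2.
Qed.

Lemma cube_root3_cvg (R : realType) (p : 'rV[R]_3) : 0 < par_z p ->
  cube_root3 (par_z q) @[q --> p] --> cube_root3 (par_z p).
Proof.
move=> z0; apply: (cvg_at_comp (f := @par_z R)).
  exact: coord_cvg.
exact: cube_root3_continuous.
Qed.

Lemma open_param_region (R : realType) K (A r : R) :
  open (param_region A r `&` sheet_interior R K).
Proof.
rewrite openE => p [[z0 /andP[v1 v2] /andP[f1 f2] hr] ht]; rewrite /interior.
have n1 := cvg_at_gt (@coord_cvg R p (ord0)) z0.
have n2 := cvg_at_gt (@coord_cvg R p (lift ord0 ord0)) v1.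
have n3 := cvg_at_lt (@coord_cvg R p (lift ord0 ord0)) v2.
have n4 := cvg_at_gt (@coord_cvg R p (lift ord0 (lift ord0 ord0))) f1.
have n5 := cvg_at_lt (@coord_cvg R p (lift ord0 (lift ord0 ord0))) f2.
have c6 : (cube_root3 (par_z q) * cube_root3 (par_z q) + A ^+ 2 -
    2 * cube_root3 (par_z q) * A * par_v q) @[q --> p] -->
    cube_root3 (par_z p) * cube_root3 (par_z p) + A ^+ 2 -
    2 * cube_root3 (par_z p) * A * par_v p.
  have c := cube_root3_cvg z0.
  apply: cvg_at_B.
    by apply: cvg_at_D; [exact: (cvg_at_M c c)|exact: cvg_at_cst].
  apply: cvg_at_M; last exact: coord_cvg.
  apply: cvg_at_M; last exact: cvg_at_cst.
  by apply: cvg_at_M; [exact: cvg_at_cst|exact: c].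
have n6 := cvg_at_lt c6 hr.
have n7 := near_sheet v1 ht.
near=> q.
have h1 : 0 < par_z q by near: q; exact: n1.
have h2 : -1 < par_v q by near: q; exact: n2.
have h3 : par_v q < 1 by near: q; exact: n3.
have h4 : - pi < par_phi q by near: q; exact: n4.
have h5 : par_phi q < pi by near: q; exact: n5.
have h6 : cube_root3 (par_z q) * cube_root3 (par_z q) + A ^+ 2 -
    2 * cube_root3 (par_z q) * A * par_v q < r ^+ 2 by near: q; exact: n6.
have [h7 /andP[h8 _]] : [/\ sheet_of K (par_v q) = sheet_of K (par_v p) &
    -1 < sheet_t K (sheet_of K (par_v p)) (par_v q) < 1] by near: q; exact: n7.
split; first by split; rewrite ?h2 ?h4.
by rewrite /sheet_interior/= h7.
Unshelve. all: by end_near. Qed.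

Lemma near_pair (R : realType) (p : 'rV[R]_3) (P : 'rV[R]_3 -> Prop) :
  (\forall q \near nbhs p, P q) -> \forall z \near (p, p), P z.1 /\ P z.2.
Proof. by move=> h; exists (P, P) => // -[q q'] []. Qed.

Lemma cvg_pair_fst (R : realType) (p : 'rV[R]_3) (f : 'rV[R]_3 -> R) (a : R) :
  f q @[q --> p] --> a ->
  f (z : 'rV[R]_3 * 'rV[R]_3).1 @[z --> (p, p)] --> a.
Proof.
by move=> h; apply: (@cvg_comp _ _ _ fst f _ (nbhs p)) => //; exact: cvg_fst.
Qed.

Lemma cvg_pair_snd (R : realType) (p : 'rV[R]_3) (f : 'rV[R]_3 -> R) (a : R) :
  f q @[q --> p] --> a ->
  f (z : 'rV[R]_3 * 'rV[R]_3).2 @[z --> (p, p)] --> a.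
Proof.
by move=> h; apply: (@cvg_comp _ _ _ snd f _ (nbhs p)) => //; exact: cvg_snd.
Qed.

(* In the coordinates (z, v, phi), with [r = (3 z)^(1/3)] and [t] affine in [v],
   the partial derivatives of [polar] are orthogonal, of lengths [1 / r^2],
   [r sqrt(N) / s] and [r s / sqrt(N)], where [N = 2 ^+ K] and
   [s = sqrt(1 - t^2)]. *)
Lemma polar_locally_unimodular (R : realType) K (A r : R) :
  locally_unimodular (param_region A r `&` sheet_interior R K) (@polar R K).
Proof.
move=> p [[z0 /andP[v1 v2] _ _] ht].
set m := sheet_of K (par_v p).
pose rad (q : 'rV[R]_3) := cube_root3 (par_z q).
pose tt (q : 'rV[R]_3) := sheet_t K m (par_v q).
pose ss (q : 'rV[R]_3) := Num.sqrt (1 - tt q * tt q).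
pose sqN : R := Num.sqrt (2 ^+ K).
have sqN0 : 0 < sqN by exact: sqrt_pow2_gt0.
have sqNE : 2 ^+ K = sqN * sqN by rewrite -expr2 sqr_sqrt_pow2.
have t1 : -1 < tt p < 1 by have [_] := nbhs_singleton (near_sheet v1 ht).
have s0gen q : -1 < tt q < 1 -> 0 < 1 - tt q * tt q.
  by move=> /andP[? ?]; nra.
have sgt0 q : -1 < tt q < 1 -> 0 < ss q by move=> ?; rewrite sqrtr_gt0 s0gen.
have sE q : -1 < tt q < 1 -> ss q * ss q = 1 - tt q * tt q.
  by move=> ?; rewrite -expr2 sqr_sqrtr// ltW// s0gen.
have sp0 := sgt0 _ t1.
have rp0 : 0 < rad p by exact: cube_root3_gt0.
(* Divided differences: [a0] of the cube root, from R^3 - R'^3 = 3 (z - z'); [a1], up to sign, of t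
   |-> sqrt(1 - t^2), from s^2 - s'^2 = t'^2 - t^2; [a2] is the ratio of chord to angle in the
   longitude. *)
pose a0 z := 3 / (rad z.1 * rad z.1 + rad z.1 * rad z.2 + rad z.2 * rad z.2).
pose a1 z := (tt z.1 + tt z.2) / (ss z.1 + ss z.2).
pose a2 (z : 'rV[R]_3 * 'rV[R]_3) := sinc ((par_phi z.1 - par_phi z.2) / 2).
pose c (i : 'I_3) z : R := match (i : nat) with
  | 0 => a0 z * a0 z
  | 1 => rad z.1 * rad z.2 * 2 ^+ K * (1 + a1 z * a1 z)
  | _ => rad z.1 * rad z.2 / 2 ^+ K * (ss z.1 * ss z.2) * (a2 z * a2 z)
  end.
pose l (i : 'I_3) : R := match (i : nat) with
  | 0 => (rad p * rad p)^-1 | 1 => rad p * sqN / ss p | _ => rad p * ss p / sqN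
  end.
have l0 i : 0 < l i.
  by rewrite /l; case: i => [[|[|i]] ?] /=;
    rewrite ?invr_gt0 ?divr_gt0// ?mulr_gt0.
exists l; split => //.
  rewrite !big_ord_recl big_ord0 /l /=; field.
  by rewrite !gt_eqF.
apply: (locally_unimodular_at (c := c) l0).
  have cr : rad q @[q --> p] --> rad p by exact: cube_root3_cvg.
  have ct : tt q @[q --> p] --> tt p by exact: sheet_t_cvg.
  have cs : ss q @[q --> p] --> ss p.
    apply: (cvg_at_comp (f := fun q => 1 - tt q * tt q) (g := Num.sqrt));
      last exact: sqrt_continuous.
    by apply: cvg_at_B; [exact: cvg_at_cst|exact: (cvg_at_M ct ct)].
  have cr1 := cvg_pair_fst cr; have cr2 := cvg_pair_snd cr.
  have ct1 := cvg_pair_fst ct; have ct2 := cvg_pair_snd ct.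
  have cs1 := cvg_pair_fst cs; have cs2 := cvg_pair_snd cs.
  have ca0 : a0 z @[z --> (p, p)] -->
      3 / (rad p * rad p + rad p * rad p + rad p * rad p).
    apply: cvg_at_M; first exact: cvg_at_cst.
    apply: cvg_at_V; first by rewrite gt_eqF// !addr_gt0// mulr_gt0.
    apply: cvg_at_D; last exact: (cvg_at_M cr2 cr2).
    by apply: cvg_at_D; [exact: (cvg_at_M cr1 cr1)|exact: (cvg_at_M cr1 cr2)].
  have ca1 : a1 z @[z --> (p, p)] --> (tt p + tt p) / (ss p + ss p).
    apply: cvg_at_M; first exact: (cvg_at_D ct1 ct2).
    apply: cvg_at_V; first by rewrite gt_eqF// addr_gt0.
    exact: (cvg_at_D cs1 cs2).
  have ca2 : a2 z @[z --> (p, p)] --> (1 : R).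
    have e0 : (par_phi p - par_phi p) / 2 = 0 by rewrite subrr mul0r.
    have <- : sinc ((par_phi p - par_phi p) / 2) = 1 by rewrite e0 /sinc eqxx.
    apply: (cvg_at_comp (f := fun z : 'rV[R]_3 * 'rV[R]_3 =>
      (par_phi z.1 - par_phi z.2) / 2)); last first.
      by rewrite e0; exact: sinc_continuous0.
    apply: cvg_at_M; last exact: cvg_at_cst.
    have cphi : par_phi q @[q --> p] --> par_phi p by exact: coord_cvg.
    exact: (cvg_at_B (cvg_pair_fst cphi) (cvg_pair_snd cphi)).
  have rN0 : rad p != 0 by rewrite gt_eqF.
  have sN0 : ss p != 0 by rewrite gt_eqF.
  have qN0 : sqN != 0 by rewrite gt_eqF.
  have sEp := sE _ t1.
  case=> [[|[|[|i]]] hi] //; rewrite /c /l /=.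
  - have -> : (rad p * rad p)^-1 ^+ 2 =
      3 / (rad p * rad p + rad p * rad p + rad p * rad p) *
      (3 / (rad p * rad p + rad p * rad p + rad p * rad p)).
      by field; rewrite rN0 gt_eqF// !addr_gt0// ?mulr_gt0.
    exact: (cvg_at_M ca0 ca0).
  - have -> : (rad p * sqN / ss p) ^+ 2 = rad p * rad p * 2 ^+ K *
      (1 + (tt p + tt p) / (ss p + ss p) * ((tt p + tt p) / (ss p + ss p))).
      have -> : (tt p + tt p) / (ss p + ss p) = tt p / ss p.
        by field; rewrite sN0 gt_eqF// addr_gt0.
      have -> : 1 + tt p / ss p * (tt p / ss p) = (ss p * ss p)^-1.
        have -> : 1 + tt p / ss p * (tt p / ss p) =
          (ss p * ss p + tt p * tt p) / (ss p * ss p) by field.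
        by rewrite sEp subrK mul1r.
      by rewrite sqNE; field.
    apply: cvg_at_M.
      by apply: cvg_at_M; [exact: (cvg_at_M cr1 cr2)|exact: cvg_at_cst].
    by apply: cvg_at_D; [exact: cvg_at_cst|exact: (cvg_at_M ca1 ca1)].
  - have -> : (rad p * ss p / sqN) ^+ 2 =
      rad p * rad p / 2 ^+ K * (ss p * ss p) * (1 * 1).
      by rewrite sqNE; field.
    apply: cvg_at_M; last exact: (cvg_at_M ca2 ca2).
    apply: cvg_at_M; last exact: (cvg_at_M cs1 cs2).
    by apply: cvg_at_M; [exact: (cvg_at_M cr1 cr2)|exact: cvg_at_cst].
have nz := cvg_at_gt (@coord_cvg R p (ord0)) z0.
have npair := near_pair (near_sheet v1 ht).
apply: (@filterS2 _ (nbhs (p, p)) _ _ _ _ _ (near_pair nz) npair) => -[q q'] /=.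
move=> [qz qz'] [[qm qt] [qm' qt']].
rewrite /polar qm qm' -/m polar_sheet_dist; last 2 first.
- by rewrite expr2 ltW// s0gen.
- by rewrite expr2 ltW// s0gen.
rewrite !big_ord_recl big_ord0 addr0 /c /= -/(par_z q) -/(par_z q')
  -/(par_v q) -/(par_v q') -/(par_phi q) -/(par_phi q').
rewrite -/(tt q) -/(tt q') !expr2 -/(ss q) -/(ss q') /sheet_rho -/(rad q) -/(rad q')
  -/sqN sqNE.
have r0 : 0 < rad q by exact: cube_root3_gt0.
have r0' : 0 < rad q' by exact: cube_root3_gt0.
have hr : rad q ^+ 3 = 3 * par_z q by exact: cube_root3K.
have hr' : rad q' ^+ 3 = 3 * par_z q' by exact: cube_root3K.
have qN0 : sqN != 0 by rewrite gt_eqF.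
have hE2 : 2 * (1 - cos (par_phi q - par_phi q')) = a2 (q, q') * a2 (q, q') *
    ((par_phi q - par_phi q') * (par_phi q - par_phi q')).
  by rewrite sinc_half !expr2.
have hE0 : a0 (q, q') * (par_z q - par_z q') = rad q - rad q'.
  have D0 : 0 < rad q * rad q + rad q * rad q' + rad q' * rad q'.
    by rewrite !addr_gt0// mulr_gt0.
  rewrite /a0 /= mulrAC; apply: (canLR (mulfK (lt0r_neq0 D0))).
  by rewrite mulrBr -hr -hr'; ring.
have ht0 : tt q - tt q' = sqN * sqN * (par_v q - par_v q').
  by rewrite /tt /sheet_t sqNE; ring.
have hE1 : (ss q - ss q') * (ss q - ss q') =
    a1 (q, q') * a1 (q, q') * ((tt q - tt q') * (tt q - tt q')).
  have S0 : 0 < ss q + ss q' by rewrite addr_gt0// sgt0.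
  have : (ss q - ss q') = - (a1 (q, q') * (tt q - tt q')).
    rewrite /a1 /= mulrAC -mulNr; apply: (canRL (mulfK (lt0r_neq0 S0))).
    have -> : (ss q - ss q') * (ss q + ss q') = ss q * ss q - ss q' * ss q' by ring.
    by rewrite !sE//; ring.
  by move=> ->; ring.
have -> : sqN * sqN * ((rad q / sqN - rad q' / sqN) * (rad q / sqN - rad q' / sqN)) =
    (rad q - rad q') * (rad q - rad q') by field.
have -> : 2 * ss q * ss q' * (1 - cos (par_phi q - par_phi q')) =
    ss q * ss q' * (2 * (1 - cos (par_phi q - par_phi q'))) by ring.
by rewrite hE1 hE2 -hE0 ht0; field.
Qed.

(** * Bijectivity of the parametrization *)

Lemma cos_eq1_small (R : realType) (x : R) :
  - (2 * pi) < x < 2 * pi -> cos x = 1 -> x = 0.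
Proof.
move=> /andP[x1 x2] cx; have h := sinc_half x.
have {}h : sinc (x / 2) ^+ 2 * x ^+ 2 = 0 by rewrite -h cx subrr mulr0.
apply/eqP/negPn/negP => xN0; move: h.
have xN2 : x / 2 != 0 by rewrite mulf_neq0 ?invr_neq0 ?pnatr_eq0.
rewrite /sinc (negbTE xN2) => /eqP; rewrite mulf_eq0 !sqrf_eq0 (negbTE xN0) orbF.
rewrite mulf_eq0 invr_eq0 (negbTE xN2) orbF => /eqP s0.
have [x0|x0] := ltP 0 x.
  have : 0 < sin (x / 2) by apply: sin_gt0_pi; apply/andP; split; lra.
  by rewrite s0 ltxx.
have {}x0 : x < 0 by rewrite lt_neqAle xN0.
have : 0 < sin (- x / 2) by apply: sin_gt0_pi; apply/andP; split; lra.
by rewrite mulNr sinN s0 oppr0 ltxx.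
Qed.

(** The base determines rho (its norm), t and the longitude; the signs of the remaining coordinates
    give the binary digits of the sheet index, and the index together with t gives v. *)
Lemma polar_injective (R : realType) K (A r : R) (p q : 'rV[R]_3) :
  (param_region A r `&` sheet_interior R K) p ->
  (param_region A r `&` sheet_interior R K) q ->
  polar K p = polar K q -> p = q.
Proof.
move=> [[pz0 /andP[pv1 pv2] /andP[pf1 pf2] _] pt0].
move=> [[qz0 /andP[qv1 qv2] /andP[qf1 qf2] _] qt0] pq.
have pm := sheet_of_lt K pv2; have qm := sheet_of_lt K qv2.
set m := sheet_of K (par_v p) in pm; set m' := sheet_of K (par_v q) in qm.
have e j : (j < K.+3)%N -> polar_entry K m p j = polar_entry K m' q j.
  move=> jK; rewrite -(@xcoord_row R K.+2 (polar_entry K m p))//.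
  rewrite -(@xcoord_row R K.+2 (polar_entry K m' q))//.
  by rewrite -/(polar_sheet K m p) -/(polar_sheet K m' q) -/(polar K p) pq.
have /andP[_ pt1] := sheet_t_bounds K pv1; have /andP[_ qt1] := sheet_t_bounds K qv1.
rewrite /sheet_interior/= -/m in pt0 pt1; rewrite /sheet_interior/= -/m' in qt0 qt1.
move: (e 0%N isT) (e 1%N isT) (e 2 isT); rewrite /polar_entry.
set t := sheet_t K m _ in pt0 pt1 *; set t' := sheet_t K m' _ in qt0 qt1 *.
set s := Num.sqrt (1 - t ^+ 2); set s' := Num.sqrt (1 - t' ^+ 2).
set rho := sheet_rho K (par_z p); set rho' := sheet_rho K (par_z q).
have rho0 : 0 < rho by exact: sheet_rho_gt0.
have rho0' : 0 < rho' by exact: sheet_rho_gt0.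
have hs0 : 0 < 1 - t ^+ 2 by nra.
have hs0' : 0 < 1 - t' ^+ 2 by nra.
have s0 : 0 < s by rewrite sqrtr_gt0.
have s0' : 0 < s' by rewrite sqrtr_gt0.
have sE : s ^+ 2 = 1 - t ^+ 2 by rewrite sqr_sqrtr// ltW.
have sE' : s' ^+ 2 = 1 - t' ^+ 2 by rewrite sqr_sqrtr// ltW.
move=> e0 e1 e2.
have c1 := cos2Dsin2 (par_phi p); have c2 := cos2Dsin2 (par_phi q).
have rr : rho = rho'.
  have h : rho ^+ 2 = rho' ^+ 2.
    have -> : rho ^+ 2 = (rho * t) ^+ 2 + (rho * (s * cos (par_phi p))) ^+ 2 +
        (rho * (s * sin (par_phi p))) ^+ 2.
      rewrite !exprMn -addrA -!mulrDr c1 sE; ring.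
    rewrite e0 e1 e2 !exprMn -addrA -!mulrDr c2 sE'; ring.
  by apply/eqP; rewrite -(@eqrXn2 _ 2%N) ?(ltW rho0) ?(ltW rho0')// h.
have tt' : t = t'.
  by move: e0; rewrite rr => /(mulfI (lt0r_neq0 rho0')).
have ss' : s = s' by rewrite /s /s' tt'.
have cc : cos (par_phi p) = cos (par_phi q).
  by move: e1; rewrite rr => /(mulfI (lt0r_neq0 rho0')); rewrite ss';
    move=> /(mulfI (lt0r_neq0 s0')).
have dd : sin (par_phi p) = sin (par_phi q).
  by move: e2; rewrite rr => /(mulfI (lt0r_neq0 rho0')); rewrite ss';
    move=> /(mulfI (lt0r_neq0 s0')).
have phiE : par_phi p = par_phi q.
  apply/eqP; rewrite -subr_eq0; apply/eqP/cos_eq1_small.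
    by apply/andP; split; lra.
  by rewrite cosB cc dd -!expr2.
have zE : par_z p = par_z q.
  have radE : cube_root3 (par_z p) = cube_root3 (par_z q).
    move: rr; rewrite /rho /rho' /sheet_rho.
    by move/(mulIf (invr_neq0 (lt0r_neq0 (sqrt_pow2_gt0 R K)))).
  have : 3 * par_z p = 3 * par_z q by rewrite -!cube_root3K// radE.
  by move/(mulfI (_ : 3 != 0 :> R)); apply; rewrite pnatr_eq0.
have mm : m = m'.
  rewrite -(binary_sum pm) -(binary_sum qm); apply: eq_bigr => l _.
  congr (_ * _)%N; congr nat_of_bool.
  have := e l.+3 (ltn_ord l); rewrite /polar_entry -/rho -/rho' rr.
  move/(mulfI (lt0r_neq0 rho0'))/(mulIf (lt0r_neq0 (sqrt_pow2_gt0 R l))).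
  rewrite /digit_sign; do 2! case: odd => //.
    by move=> h; exfalso; lra.
  by move=> h; exfalso; lra.
have vE : par_v p = par_v q.
  move: tt'; rewrite /t /t' /sheet_t mm => /addIr/addIr/addIr.
  by apply: mulfI; rewrite expf_neq0// pnatr_eq0.
apply/rowP => i; move: zE vE phiE; rewrite /par_z /par_v /par_phi.
case: i => [[|[|[|i]]] hi] //= h0 h1 h2.
- by rewrite (_ : Ordinal hi = ord0)//; exact: val_inj.
- by rewrite (_ : Ordinal hi = lift ord0 ord0)//; exact: val_inj.
- by rewrite (_ : Ordinal hi = lift ord0 (lift ord0 ord0))//; exact: val_inj.
Qed.

(** [acos] finds the angle up to sign, and the sign of [d] decides; [d != 0] keeps it away from
    pi. *)
Lemma polar_coordinates_exist (R : realType) (c d : R) :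
  c ^+ 2 + d ^+ 2 = 1 -> d != 0 ->
  exists2 phi : R, - pi < phi < pi & cos phi = c /\ sin phi = d.
Proof.
move=> cd dN0; have d2 : 0 < d ^+ 2 by rewrite exprn_even_gt0.
have c1 : -1 < c < 1 by apply/andP; split; nra.
have cc : -1 <= c <= 1 by move: c1 => /andP[/ltW-> /ltW->].
have a0 : 0 < acos c by apply: acos_gt0; move: c1 => /andP[/ltW-> ->].
have a1 : acos c < pi by apply: acos_ltpi; move: c1 => /andP[-> /ltW->].
have cosa : cos (acos c) = c by apply: acosK; rewrite in_itv.
have sina : sin (acos c) = `|d|.
  by rewrite sin_acos// -cd addrC addKr sqrtr_sqr.
have pi0 := pi_gt0 R.
have [dp|dn] := ltP 0 d.
  exists (acos c); first by apply/andP; split; lra.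
  by rewrite cosa sina gtr0_norm.
exists (- acos c); first by apply/andP; split; lra.
by rewrite cosN sinN cosa sina ler0_norm// opprK.
Qed.

(** A nonzero third coordinate keeps the base off the polar axis and off the half-plane of longitude
    pi, so all strict bounds hold. The sheet is read off from the signs of the remaining
    coordinates, and [v] and [z] are found by inverting [sheet_t] and [sheet_rho]. *)
Lemma polar_surjective (R : realType) K (y : 'rV[R]_K.+3) :
  cone R K y -> xcoord y 3 != 0 ->
  exists p : 'rV[R]_3, [/\ 0 < par_z p, -1 < par_v p < 1, - pi < par_phi p < pi,
    sheet_interior R K p & polar K p = y].
Proof.
move=> cy y3; set y0 := xcoord y 1; set y1 := xcoord y 2; set y2 := xcoord y 3.
have y2sq : 0 < y2 ^+ 2 by rewrite exprn_even_gt0.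
pose q := y0 ^+ 2 + y1 ^+ 2 + y2 ^+ 2.
have q0 : 0 < q by rewrite ltr_wpDl// addr_ge0 ?sqr_ge0.
pose rho := Num.sqrt q; have rho0 : 0 < rho by rewrite sqrtr_gt0.
have rhoE : rho ^+ 2 = q by rewrite sqr_sqrtr// ltW.
have rhoN0 : rho != 0 by rewrite gt_eqF.
pose t := y0 / rho.
have tE : rho * t = y0 by rewrite /t mulrC divfK.
have hs : 0 < 1 - t ^+ 2.
  have -> : 1 - t ^+ 2 = (q - y0 ^+ 2) / rho ^+ 2.
    by rewrite -rhoE /t; field.
  rewrite divr_gt0 ?exprn_gt0// /q; have := sqr_ge0 y1; lra.
pose s := Num.sqrt (1 - t ^+ 2); have s0 : 0 < s by rewrite sqrtr_gt0.
have sE : s ^+ 2 = 1 - t ^+ 2 by rewrite sqr_sqrtr// ltW.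
have sN0 : s != 0 by rewrite gt_eqF.
have rs : (rho * s) ^+ 2 = y1 ^+ 2 + y2 ^+ 2.
  by rewrite exprMn sE mulrBr -exprMn tE rhoE /q; ring.
have [phi phipi [cphi sphi]] : exists2 phi : R, - pi < phi < pi &
    cos phi = y1 / (rho * s) /\ sin phi = y2 / (rho * s).
  apply: polar_coordinates_exist; last by rewrite mulf_neq0// invr_neq0// mulf_neq0.
  by rewrite !expr_div_n -mulrDl -rs divff// expf_neq0// mulf_neq0.
have [mK mdig] := binary_digits K (fun l => 0 < xcoord y l.+4).
set m := (\sum_(l < K) _)%N in mK mdig.
have t1 : -1 < t < 1 by apply/andP; split; nra.
have N0 : 0 < 2 ^+ K :> R by rewrite exprn_gt0.
pose v : R := (t + 2 * m%:R + 1 - 2 ^+ K) / 2 ^+ K.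
have vE : 2 ^+ K * v = t + 2 * m%:R + 1 - 2 ^+ K by rewrite mulrC divfK// gt_eqF.
have vt : sheet_t K m v = t by rewrite /sheet_t vE; ring.
have mS : sheet_of K v = m.
  by apply: sheet_of_def; rewrite vt; move: t1 => /andP[/ltW-> ->].
have mK' : m%:R + 1 <= 2 ^+ K :> R by rewrite -natrX natr1 ler_nat.
have m0 : 0 <= m%:R :> R by [].
have v1 : -1 < v < 1.
  move: t1 => /andP[ta tb].
  apply/andP; split; rewrite -(ltr_pM2l N0) vE ?mulrN mulr1; lra.
pose RR := Num.sqrt (2 ^+ K) * rho.
have RR0 : 0 < RR by rewrite mulr_gt0// sqrt_pow2_gt0.
pose z := RR ^+ 3 / 3; have z0 : 0 < z by rewrite divr_gt0// exprn_gt0.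
have radE : cube_root3 z = RR.
  have : cube_root3 z ^+ 3 = RR ^+ 3 by rewrite cube_root3K// /z mulrC divfK ?pnatr_eq0.
  move/eqP; rewrite eqrXn2// => [/eqP//||]; rewrite ltW//; exact: cube_root3_gt0.
have rhoK : sheet_rho K z = rho.
  by rewrite /sheet_rho radE /RR mulrAC divff ?mul1r// gt_eqF// sqrt_pow2_gt0.
exists (\row_(i < 3) match (i : nat) with 0 => z | 1 => v | _ => phi end).
rewrite /par_z /par_v /par_phi /sheet_interior /polar /= /par_v !mxE /= mS vt.
split=> //; first by move: t1 => /andP[].
apply/rowP => j; rewrite !mxE /polar_entry /par_z /par_v /par_phi !mxE /= rhoK vt.
rewrite xcoordE -/s cphi sphi; case: j => [[|[|[|l]]] hl] /=.
- exact: tE.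
- by rewrite mulrA mulrCA divff ?mulr1// mulf_neq0.
- by rewrite mulrA mulrCA divff ?mulr1// mulf_neq0.
rewrite /digit_sign mdig//.
have w0 := sqrt_pow2_gt0 R l; set w := Num.sqrt (2 ^+ l) in w0 *.
have h : xcoord y l.+4 ^+ 2 = (w * rho) ^+ 2.
  by rewrite exprMn sqr_sqrt_pow2 rhoE; exact: cy.
have wr : 0 < w * rho by rewrite mulr_gt0.
case: ltP => hy.
  have : xcoord y l.+4 = w * rho.
    by apply/eqP; rewrite -(@eqrXn2 _ 2%N) ?(ltW hy) ?(ltW wr)// h.
  by move=> ->; ring.
have : - xcoord y l.+4 = w * rho.
  by apply/eqP; rewrite -(@eqrXn2 _ 2%N) ?oppr_ge0 ?(ltW wr)// sqrrN h.
by move=> /(canRL opprK) ->; ring.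
Qed.

(** * The measure of balls of the cone *)

Lemma hausdorff3_raw_null_cover (R : realType) n (I : finType)
    (A : set 'rV[R]_n) (Z : I -> set 'rV[R]_n) :
  (forall i, hausdorff3_raw (Z i) = 0%E) -> A `<=` \bigcup_i Z i ->
  hausdorff3_raw A = 0%E.
Proof.
move=> Z0 AZ; apply/eqP; rewrite eq_le hausdorff3_raw_ge0 andbT.
apply: le_trans (hausdorff3_raw_mono AZ) _.
apply: le_trans (hausdorff3_raw_subadd_fin _) _.
by rewrite big1.
Qed.

(** The reverse triangle inequality in the plane, from Cauchy-Schwarz in the form (a d - b c)^2 >=
    0. *)
Lemma sqrt_sum_sqr_lipschitz (R : realType) (a b c d : R) :
  (Num.sqrt (a ^+ 2 + b ^+ 2) - Num.sqrt (c ^+ 2 + d ^+ 2)) ^+ 2 <=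
  (a - c) ^+ 2 + (b - d) ^+ 2.
Proof.
have X0 : 0 <= a ^+ 2 + b ^+ 2 by rewrite addr_ge0 ?sqr_ge0.
have Y0 : 0 <= c ^+ 2 + d ^+ 2 by rewrite addr_ge0 ?sqr_ge0.
have h : a * c + b * d <= Num.sqrt (a ^+ 2 + b ^+ 2) * Num.sqrt (c ^+ 2 + d ^+ 2).
  rewrite -sqrtrM//; apply: le_trans (ler_norm _) _.
  rewrite -sqrtr_sqr; apply: ler_wsqrtr.
  have := sqr_ge0 (a * d - b * c); lra.
have e1 := sqr_sqrtr X0; have e2 := sqr_sqrtr Y0.
set x := Num.sqrt _ in h e1 *; set y := Num.sqrt _ in h e2 *.
have -> : (x - y) ^+ 2 = x ^+ 2 + y ^+ 2 - 2 * (x * y) by ring.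
rewrite e1 e2; lra.
Qed.

(** Over the plane x_3 = 0 the cone is a finite union of graphs of sqrt(N)-Lipschitz maps, the
    images of a flat box, which has measure 0. *)
Lemma cone_slice_null (R : realType) K (M : R) : 0 <= M ->
  hausdorff3_raw (cone R K `&`
    [set y | [/\ xcoord y 3 = 0, `|xcoord y 1| <= M & `|xcoord y 2| <= M]]) = 0%E.
Proof.
move=> M0.
pose ent (m : nat) (u : 'rV[R]_3) (j : nat) : R := match j with
  | 0 => par_z u | 1 => par_v u | 2 => 0
  | l.+3 => digit_sign R m l * Num.sqrt (2 ^+ l) *
            Num.sqrt (par_z u ^+ 2 + par_v u ^+ 2) end.
pose gr m u : 'rV[R]_K.+3 := \row_(j < K.+3) ent m u j.
pose lo (i : 'I_3) : R := if i == lift ord0 (lift ord0 ord0) then 0 else - M.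
pose hi (i : 'I_3) : R := if i == lift ord0 (lift ord0 ord0) then 0 else M.
have flat : hausdorff3_raw (box3 lo hi) = 0%E.
  apply: (hausdorff3_raw_box3_flat (i := lift ord0 (lift ord0 ord0))).
    by move=> i; rewrite /lo /hi; case: ifP => // _; rewrite lerNl ge0_cp// oppr_le0.
  by rewrite /lo /hi eqxx.
apply: (@hausdorff3_raw_null_cover _ _ 'I_(2 ^ K) _
  (fun m : 'I_(2 ^ K) => gr m @` box3 lo hi)) => [m|y [cy [y3 y1 y2]]].
  apply/eqP; rewrite eq_le hausdorff3_raw_ge0 andbT.
  apply: (@le_trans _ _ ((Num.sqrt (2 ^+ K) ^+ 3)%:E *
      hausdorff3_raw (id @` box3 lo hi))%E).
    apply: hausdorff3_raw_lipschitz => [|u w _ _]; first exact: sqrt_pow2_gt0.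
    apply: eucl_dist_le_sqr; first by rewrite mulr_ge0 ?eucl_dist_ge0// sqrtr_ge0.
    rewrite exprMn sqr_sqrt_pow2 sqr_eucl_dist.
    under eq_bigr do rewrite !mxE.
    rewrite (big_ord_recl3 K (fun j => (ent m u j - ent m w j) ^+ 2)).
    set X := Num.sqrt (par_z u ^+ 2 + par_v u ^+ 2).
    set Y := Num.sqrt (par_z w ^+ 2 + par_v w ^+ 2).
    rewrite (eq_bigr (fun l : 'I_K => (X - Y) ^+ 2 * 2 ^+ l)); last first.
      move=> l _; rewrite /ent -/X -/Y -mulrBr !exprMn digit_sign_sqr sqr_sqrt_pow2.
      by rewrite mul1r mulrC.
    rewrite -mulr_sumr sum_pow2 !big_ord_recl big_ord0 /ent /=.
    rewrite -/(par_z u) -/(par_z w) -/(par_v u) -/(par_v w) -/(par_phi u) -/(par_phi w).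
    have h := sqrt_sum_sqr_lipschitz (par_z u) (par_v u) (par_z w) (par_v w).
    rewrite -/X -/Y in h.
    have P0 : 0 <= 2 ^+ K - 1 :> R by rewrite subr_ge0 exprn_ege1// ler1n.
    have h2 := ler_wpM2r P0 h.
    have h3 : 0 <= 2 ^+ K * (par_phi u - par_phi w) ^+ 2.
      by rewrite mulr_ge0 ?sqr_ge0// exprn_ge0.
    lra.
  by rewrite image_id flat mule0.
have [mK mdig] := binary_digits K (fun l => 0 < xcoord y l.+4).
set m := (\sum_(l < K) _)%N in mK mdig.
exists (Ordinal mK) => //.
exists (\row_(i < 3) match (i : nat) with
  | 0 => xcoord y 1 | 1 => xcoord y 2 | _ => 0 end).
  move=> i; rewrite mxE /lo /hi; case: i => [[|[|[|i]]] hi0] //=.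
  - by rewrite -ler_norml.
  - by rewrite -ler_norml.
  - by rewrite lexx.
apply/rowP => j; rewrite !mxE /ent /par_z /par_v !mxE/= xcoordE.
case: j => [[|[|[|l]]] hl] //=.
rewrite /digit_sign mdig//.
have w0 := sqrt_pow2_gt0 R l; set w := Num.sqrt (2 ^+ l) in w0 *.
set q := xcoord y 1 ^+ 2 + xcoord y 2 ^+ 2.
have q0 : 0 <= q by rewrite addr_ge0 ?sqr_ge0.
have h : xcoord y l.+4 ^+ 2 = (w * Num.sqrt q) ^+ 2.
  by rewrite exprMn sqr_sqrt_pow2 sqr_sqrtr// (cy l hl) y3 expr0n addr0.
have wr : 0 <= w * Num.sqrt q by rewrite mulr_ge0 ?sqrtr_ge0// ltW.
case: ltP => hy.
  have -> : xcoord y l.+4 = w * Num.sqrt q.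
    by apply/eqP; rewrite -(@eqrXn2 _ 2%N) ?(ltW hy)// h.
  by rewrite mul1r.
have : - xcoord y l.+4 = w * Num.sqrt q.
  by apply/eqP; rewrite -(@eqrXn2 _ 2%N) ?oppr_ge0// sqrrN h.
by move=> /(canRL opprK) ->; ring.
Qed.

Lemma param_region_bound (R : realType) (A r : R) p : 0 <= A -> 0 < r ->
  param_region A r p -> par_z p <= (A + r) ^+ 3 / 3.
Proof.
move=> A0 r0 [z0 /andP[v1 v2] _ h]; rewrite ler_pdivlMr// mulrC -cube_root3K//.
have R0 := cube_root3_gt0 (par_z p); set rr := cube_root3 _ in h R0 *.
have h2 : (rr - A) ^+ 2 < r ^+ 2.
  (* Replacing v by its bound 1 turns the quadratic expression into (R - A)^2. *)
  apply: le_lt_trans h.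
  have : 0 <= 2 * rr * A * (1 - par_v p).
    by rewrite !mulr_ge0 ?(ltW R0)// subr_ge0 ltW.
  lra.
have h3 : rr - A <= r by nra.
by rewrite ler_pXn2r ?nnegrE ?(ltW R0) ?addr_ge0 ?(ltW r0)//; lra.
Qed.

(** On a wall t = -1, that is v = (2 m - N) / N. Because the region is bounded, its part in the
    walls lies in finitely many boxes that are flat in the v-direction. *)
Lemma param_region_walls (R : realType) K (A r : R) : 0 <= A -> 0 < r ->
  hausdorff3_raw (param_region A r) =
  hausdorff3_raw (param_region A r `&` sheet_interior R K).
Proof.
move=> A0 r0; have N0 : 0 < 2 ^+ K :> R by rewrite exprn_gt0.
pose vm (m : nat) : R := (2 * m%:R - 2 ^+ K) / 2 ^+ K.
pose lo (m : nat) (i : 'I_3) : R := match (i : nat) with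
  | 0 => 0 | 1 => vm m | _ => - pi end.
pose hi (m : nat) (i : 'I_3) : R := match (i : nat) with
  | 0 => (A + r) ^+ 3 / 3 | 1 => vm m | _ => pi end.
have Ar0 : 0 <= (A + r) ^+ 3 / 3 by rewrite divr_ge0// exprn_ge0// addr_ge0// ltW.
pose W := \bigcup_(m : 'I_(2 ^ K)) box3 (lo m) (hi m).
have W0 : hausdorff3_raw W = 0%E.
  apply: (@hausdorff3_raw_null_cover _ _ 'I_(2 ^ K) _
    (fun m : 'I_(2 ^ K) => box3 (lo m) (hi m))) => [m|//].
  apply: (hausdorff3_raw_box3_flat (i := lift ord0 ord0)) => //.
  move=> i; rewrite /lo /hi; case: i => [[|[|i]] hi0] //=.
  by rewrite ge0_cp// pi_ge0.
apply: (hausdorff3_raw_addnull W0) => [p []//|p hp].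
have [z0 /andP[v1 v2] /andP[f1 f2] _] := hp.
have [h|h] := ltP (-1) (sheet_t K (sheet_of K (par_v p)) (par_v p)).
  by left.
right; exists (Ordinal (sheet_of_lt K v2)) => //.
have /andP[h' _] := sheet_t_bounds K v1.
have vE : par_v p = vm (sheet_of K (par_v p)).
  have : sheet_t K (sheet_of K (par_v p)) (par_v p) = -1.
    by apply/eqP; rewrite eq_le h h'.
  rewrite /sheet_t /vm => e; apply: (canRL (mulfK (lt0r_neq0 N0))); lra.
have hb := param_region_bound A0 r0 hp.
move: z0 v1 v2 f1 f2 vE hb; rewrite /par_z /par_v /par_phi => z0 v1 v2 f1 f2 vE hb i.
rewrite /lo /hi /=; case: i => [[|[|[|i]]] hi0] //=.
- by rewrite (_ : Ordinal hi0 = ord0) ?(ltW z0)//; exact: val_inj.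
- by rewrite (_ : Ordinal hi0 = lift ord0 ord0) -?vE ?lexx//; exact: val_inj.
- by rewrite (_ : Ordinal hi0 = lift ord0 (lift ord0 ord0)) ?(ltW f1) ?(ltW f2)//;
    exact: val_inj.
Qed.

(** [polar] maps the region without its walls into the ball, and reaches every point of the ball
    outside the slice x_3 = 0. In the ball the first two coordinates are at most r + a in absolute
    value, so the part in the slice is null. *)
Lemma cone_open_ball_axis (R : realType) K (a r : R) : 0 <= a -> 0 < r ->
  hausdorff3_raw (cone R K `&` [set y | eucl_dist y (cone_axis K a) < r]) =
  hausdorff3_raw (param_region (Num.sqrt (2 ^+ K) * a) r).
Proof.
move=> a0 r0; set A := Num.sqrt _ * a.
have A0 : 0 <= A by rewrite mulr_ge0 ?sqrtr_ge0.
rewrite (param_region_walls K A0 r0).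
rewrite -(locally_unimodular_image (@open_param_region R K A r)
  (@polar_locally_unimodular R K A r) (@polar_injective R K A r)).
have ball_sqr (y : 'rV[R]_K.+3) : (eucl_dist y (cone_axis K a) < r) =
    (eucl_dist y (cone_axis K a) ^+ 2 < r ^+ 2).
  by rewrite ltr_pXn2r// nnegrE ?eucl_dist_ge0// ltW.
have tsq v : -1 < v -> 0 <= 1 - sheet_t K (sheet_of K v) v ^+ 2.
  by move=> v1; have /andP[? ?] := sheet_t_bounds K v1; nra.
apply: (hausdorff3_raw_addnull (cone_slice_null K (M := r + a) _)).
- by rewrite addr_ge0// ltW.
- move=> _ [p [[z0 /andP[v1 v2] _ h] _] <-]; split.
    exact/polar_sheet_cone/tsq.
  by rewrite /= ball_sqr polar_sheet_axis_dist ?sheet_of_lt// tsq.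
- move=> y [cy yr].
  have [y3|y3] := eqVneq (xcoord y 3) 0.
    right; split => //; split => //.
    + have := coord_le_eucl_dist y (cone_axis K a) (inord 0).
      rewrite -/(xcoord y 1) /cone_axis mxE inordK// mulr1 => h.
      have := le_lt_trans h yr; rewrite ltr_norml ler_norml => /andP[? ?].
      by apply/andP; split; lra.
    + have := coord_le_eucl_dist y (cone_axis K a) (inord 1).
      rewrite -/(xcoord y 2) /cone_axis mxE inordK// mulr0 subr0 => h.
      by apply: le_trans h _; rewrite ltW// (lt_le_trans yr)// lerDl.
  left; have [p [z0 v1 f1 ht py]] := polar_surjective cy y3.
  exists p => //; split => //; split => //.
  move: (yr); rewrite /= ball_sqr -py polar_sheet_axis_dist//.
  - by apply: sheet_of_lt; case/andP: v1.
  - by apply: tsq; case/andP: v1.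
Qed.

Lemma cone0 (R : realType) : cone R 0 = setT.
Proof. by apply/seteqP; split. Qed.

(** [cone_open_ball_axis] is read backwards for K = 0, where sqrt(2^0) = 1 and so a = A: both
    regions have the measure of a Euclidean ball of R^3 of radius [r]. *)
Lemma param_region_center (R : realType) (A r : R) : 0 <= A -> 0 < r ->
  hausdorff3_raw (param_region A r) = hausdorff3_raw (param_region 0 r).
Proof.
move=> A0 r0.
have := @cone_open_ball_axis R 0 A r A0 r0.
have := @cone_open_ball_axis R 0 0 r (lexx 0) r0.
rewrite expr0 sqrtr1 !mul1r cone0 !setTI => <- <-.
pose tr (y : 'rV[R]_3) : 'rV[R]_3 := y + (cone_axis 0 A - cone_axis 0 0).
have -> : [set y : 'rV[R]_3 | eucl_dist y (cone_axis 0 A) < r] =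
    tr @` [set y : 'rV[R]_3 | eucl_dist y (cone_axis 0 0) < r].
  apply/seteqP; split => [y hy|_ [y hy <-]].
  - exists (y - (cone_axis 0 A - cone_axis 0 0)); last by rewrite /tr subrK.
    move: hy; rewrite /= /eucl_dist; congr (Num.sqrt _ < _).
    by apply: eq_bigr => i _; rewrite !mxE; congr (_ ^+ 2); ring.
  - move: hy; rewrite /= /eucl_dist; congr (Num.sqrt _ < _).
    by apply: eq_bigr => i _; rewrite !mxE; congr (_ ^+ 2); ring.
rewrite -[in RHS](image_id [set y | _]); apply: hausdorff3_raw_isometry.
move=> p q _ _; congr Num.sqrt; apply: eq_bigr => i _; rewrite !mxE.
by congr (_ ^+ 2); ring.
Qed.

(** The difference lies in the six faces, each a flat box. *)
Lemma hausdorff3_raw_open_box3 (R : realType) (lo hi : 'I_3 -> R) :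
  (forall i, lo i <= hi i) ->
  hausdorff3_raw [set x : 'rV[R]_3 | forall i, lo i < x ord0 i < hi i] =
  hausdorff3_raw (box3 lo hi).
Proof.
move=> lohi; apply/esym.
pose e (ib : 'I_3 * bool) := if ib.2 then lo ib.1 else hi ib.1.
pose W := \bigcup_(ib : 'I_3 * bool) box3 (upd3 lo ib.1 (e ib)) (upd3 hi ib.1 (e ib)).
have W0 : hausdorff3_raw W = 0%E.
  apply: (hausdorff3_raw_null_cover (Z := fun ib : 'I_3 * bool =>
    box3 (upd3 lo ib.1 (e ib)) (upd3 hi ib.1 (e ib)))) => [ib|//].
  apply: (hausdorff3_raw_box3_flat (i := ib.1)); last by rewrite /upd3 eqxx.
  by move=> i; rewrite /upd3; case: ifP.
apply: (hausdorff3_raw_addnull W0) => x hx.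
  by move=> i; have /andP[/ltW-> /ltW->] := hx i.
have [h|] := pselect (forall i, lo i < x ord0 i < hi i); first by left.
move=> /existsNP[i /negP]; rewrite negb_and -!leNgt => hi'; right.
have /andP[h1 h2] := hx i.
have [b xe] : exists b, x ord0 i = e (i, b).
  by case/orP: hi' => h; [exists true|exists false]; apply/eqP;
    rewrite eq_le ?h ?h1 ?h2.
exists (i, b) => // j; rewrite /upd3 /=; case: eqP => [->|_]; last exact: hx.
by rewrite xe lexx.
Qed.

(** For A = 0 the last condition reads z < r^3 / 3, so the region is an open box with edges r^3 / 3,
    2 and 2 pi. *)
Lemma param_region0 (R : realType) (r : R) : 0 < r ->
  hausdorff3_raw (param_region 0 r) =
  ((4 / 3 * pi * r ^+ 3)%:E * hausdorff3_raw (unit_cube3 R))%E.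
Proof.
move=> r0; pose lo (i : 'I_3) : R := match (i : nat) with
  | 0 => 0 | 1 => -1 | _ => - pi end.
pose hi (i : 'I_3) : R := match (i : nat) with
  | 0 => r ^+ 3 / 3 | 1 => 1 | _ => pi end.
have pi0 := pi_ge0 R.
have lohi i : lo i <= hi i.
  rewrite /lo /hi; case: i => [[|[|i]] h] /=; last 2 first.
  - by rewrite ge0_cp.
  - by rewrite ge0_cp.
  - by rewrite divr_ge0// exprn_ge0// ltW.
have -> : param_region 0 r = [set x : 'rV[R]_3 | forall i, lo i < x ord0 i < hi i].
  have E p : 0 < par_z p -> (cube_root3 (par_z p) ^+ 2 + 0 ^+ 2 -
      2 * cube_root3 (par_z p) * 0 * par_v p < r ^+ 2) = (par_z p < r ^+ 3 / 3).
    move=> z0; rewrite expr0n addr0 mulr0 mul0r subr0 ltr_pdivlMr// mulrC.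
    rewrite -cube_root3K//.
    by rewrite !ltr_pXn2r// nnegrE ltW// cube_root3_gt0.
  apply/seteqP; split => [p [z0 v1 f1]|p hp].
    rewrite E// => hz i; rewrite /lo /hi; move: z0 v1 f1 hz.
    rewrite /par_z /par_v /par_phi; case: i => [[|[|[|i]]] h] //= z0 v1 f1 hz.
    - by rewrite (_ : Ordinal h = ord0) ?z0//; exact: val_inj.
    - by rewrite (_ : Ordinal h = lift ord0 ord0)//; exact: val_inj.
    - by rewrite (_ : Ordinal h = lift ord0 (lift ord0 ord0))//; exact: val_inj.
  have /andP[z0 z1] := hp ord0.
  have := hp (lift ord0 (lift ord0 ord0)).
  by split; rewrite ?E//; exact: (hp (lift ord0 ord0)).
rewrite hausdorff3_raw_open_box3// hausdorff3_raw_box3//; congr (_%:E * _)%E.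
by rewrite !big_ord_recl big_ord0 /lo /hi /=; field.
Qed.

(* The Householder reflection of R^3 exchanging the base of [x] with a multiple of
   the first basis vector, together with sign changes on the other coordinates;
   when the reflection vector vanishes, [0^-1 = 0] makes it the identity. *)
Lemma cone_isometry (R : realType) K (x : 'rV[R]_K.+3) : cone R K x ->
  exists (a : R) (g : 'rV[R]_K.+3 -> 'rV[R]_K.+3),
    [/\ 0 <= a, g x = cone_axis K a, involutive g,
        forall y y', eucl_dist (g y) (g y') = eucl_dist y y' &
        forall y, cone R K y -> cone R K (g y)].
Proof.
move=> cx; set x0 := xcoord x 1; set x1 := xcoord x 2; set x2 := xcoord x 3.
pose a := Num.sqrt (x0 ^+ 2 + x1 ^+ 2 + x2 ^+ 2).
have a0 : 0 <= a by exact: sqrtr_ge0.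
have aE : a ^+ 2 = x0 ^+ 2 + x1 ^+ 2 + x2 ^+ 2.
  by rewrite sqr_sqrtr// !addr_ge0 ?sqr_ge0.
pose n0 := x0 - a; pose nn := n0 ^+ 2 + x1 ^+ 2 + x2 ^+ 2.
pose k := nn^-1.
(* The reflection is an involutive isometry by this identity alone, which survives nn = 0 because
   0^-1 = 0. *)
have kE : k * nn * k = k.
  have [h|h] := eqVneq nn 0; first by rewrite /k h invr0 mulr0.
  by rewrite /k mulVf// mul1r.
pose ip (u0 u1 u2 : R) := u0 * n0 + u1 * x1 + u2 * x2.
pose tau l : R := if 0 <= xcoord x l.+4 then 1 else -1.
have tau2 l : tau l ^+ 2 = 1 by rewrite /tau; case: ifP; rewrite ?sqrrN expr1n.
pose ref (u0 u1 u2 c uj : R) := uj - 2 * k * ip u0 u1 u2 * c.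
pose ent (y : 'rV[R]_K.+3) (j : nat) : R :=
  let w := ref (xcoord y 1) (xcoord y 2) (xcoord y 3) in
  match j with
  | 0 => w n0 (xcoord y 1) | 1 => w x1 (xcoord y 2) | 2 => w x2 (xcoord y 3)
  | l.+3 => tau l * xcoord y l.+4
  end.
pose g (y : 'rV[R]_K.+3) : 'rV[R]_K.+3 := \row_(j < K.+3) ent y j.
have gE y j : (j < K.+3)%N -> xcoord (g y) j.+1 = ent y j.
  by move=> jK; rewrite (xcoord_row (ent y)).
have ref_norm u0 u1 u2 :
    ref u0 u1 u2 n0 u0 ^+ 2 + ref u0 u1 u2 x1 u1 ^+ 2 + ref u0 u1 u2 x2 u2 ^+ 2 =
    u0 ^+ 2 + u1 ^+ 2 + u2 ^+ 2.
  have -> : ref u0 u1 u2 n0 u0 ^+ 2 + ref u0 u1 u2 x1 u1 ^+ 2 +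
      ref u0 u1 u2 x2 u2 ^+ 2 = u0 ^+ 2 + u1 ^+ 2 + u2 ^+ 2 +
      4 * ip u0 u1 u2 ^+ 2 * (k * nn * k - k) by rewrite /ref /ip /nn; ring.
  by rewrite kE subrr mulr0 addr0.
have ip_ref u0 u1 u2 : k * ip (ref u0 u1 u2 n0 u0) (ref u0 u1 u2 x1 u1)
    (ref u0 u1 u2 x2 u2) = - (k * ip u0 u1 u2).
  have -> : k * ip (ref u0 u1 u2 n0 u0) (ref u0 u1 u2 x1 u1) (ref u0 u1 u2 x2 u2) =
    k * ip u0 u1 u2 - 2 * (k * nn * k) * ip u0 u1 u2 by rewrite /ref /ip /nn; ring.
  by rewrite kE; ring.
exists a, g; split => //.
(* Since the base of [x] has norm [a], twice its product with the reflection vector is the squared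
   norm of that vector; the reflection thus subtracts exactly the vector and leaves (a, 0, 0). *)
- have ipx : 2 * ip x0 x1 x2 = nn.
    rewrite /ip /nn /n0; have := aE; lra.
  have refx c : ref x0 x1 x2 c =1 (fun uj => uj - k * nn * c).
    by move=> uj; rewrite /ref -ipx; ring.
  have fixx c : (nn = 0 -> c = 0) -> k * nn * c = c.
    have [h|h _] := eqVneq nn 0; last by rewrite /k mulVf// mul1r.
    by move=> /(_ h) ->; rewrite mulr0.
  have nn0 : nn = 0 -> [/\ n0 = 0, x1 = 0 & x2 = 0].
    have h0 := sqr_ge0 n0; have h1 := sqr_ge0 x1; have h2 := sqr_ge0 x2.
    rewrite /nn => e; split; apply/eqP; rewrite -sqrf_eq0; apply/eqP; lra.
  apply/rowP => j; rewrite !mxE; case: j => [[|[|[|l]]] hl] /=.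
  + rewrite refx fixx; last by move=> /nn0[].
    by rewrite /n0 -/x0; ring.
  + by rewrite refx fixx ?subrr ?mulr0//; move=> /nn0[].
  + by rewrite refx fixx ?subrr ?mulr0//; move=> /nn0[].
  + have h : xcoord x l.+4 ^+ 2 = (a * Num.sqrt (2 ^+ l)) ^+ 2.
      by rewrite exprMn sqr_sqrt_pow2 aE mulrC; exact: cx.
    have w0 : 0 <= a * Num.sqrt (2 ^+ l) by rewrite mulr_ge0 ?sqrtr_ge0.
    rewrite /tau; case: ifPn => h0.
      by rewrite mul1r; apply/eqP; rewrite -(@eqrXn2 _ 2%N)// h.
    rewrite -ltNge in h0.
    rewrite mulN1r; apply/eqP.
    by rewrite -(@eqrXn2 _ 2%N) ?oppr_ge0 ?(ltW h0)// sqrrN h.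
- move=> y; apply/rowP => j; rewrite !mxE xcoordE.
  have r2 c u0 u1 u2 uj : ref (ref u0 u1 u2 n0 u0) (ref u0 u1 u2 x1 u1)
      (ref u0 u1 u2 x2 u2) c (ref u0 u1 u2 c uj) = uj.
    have -> : ref (ref u0 u1 u2 n0 u0) (ref u0 u1 u2 x1 u1)
      (ref u0 u1 u2 x2 u2) c (ref u0 u1 u2 c uj) = uj - 2 * k * ip u0 u1 u2 * c -
      2 * (k * ip (ref u0 u1 u2 n0 u0) (ref u0 u1 u2 x1 u1) (ref u0 u1 u2 x2 u2)) * c.
      by rewrite {1}/ref [X in X - _]/ref; ring.
    by rewrite ip_ref; ring.
  case: j => [[|[|[|l]]] hl] /=; rewrite !gE//=.
  by rewrite mulrA -expr2 tau2 mul1r.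
- move=> y y'; congr Num.sqrt.
  under eq_bigr do rewrite !mxE.
  under [RHS]eq_bigr do rewrite !xcoordE.
  rewrite (big_ord_recl3 K (fun j => (ent y j - ent y' j) ^+ 2)).
  rewrite (big_ord_recl3 K (fun j => (xcoord y j.+1 - xcoord y' j.+1) ^+ 2)).
  congr (_ + _); last first.
    by apply: eq_bigr => l _; rewrite /= -mulrBr exprMn tau2 mul1r.
  rewrite -(ref_norm (xcoord y 1 - xcoord y' 1)) /=.
  by congr (_ ^+ 2 + _ ^+ 2 + _ ^+ 2); rewrite /ref /ip; ring.
- move=> y cy l lK; rewrite !gE//= ref_norm exprMn tau2 mul1r.
  exact: cy.
Qed.

Lemma cone_open_ball (R : realType) K (x : 'rV[R]_K.+3) (r : R) :
  cone R K x -> 0 < r ->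
  hausdorff3_raw (cone R K `&` [set y | eucl_dist y x < r]) =
  ((4 / 3 * pi * r ^+ 3)%:E * hausdorff3_raw (unit_cube3 R))%E.
Proof.
move=> cx r0; have [a [g [a0 gx gK giso gcone]]] := cone_isometry cx.
rewrite -(param_region0 r0).
rewrite -(@param_region_center R (Num.sqrt (2 ^+ K) * a) r); last 2 first.
- by rewrite mulr_ge0 ?sqrtr_ge0.
- by [].
rewrite -cone_open_ball_axis//.
have -> : cone R K `&` [set y | eucl_dist y (cone_axis K a) < r] =
    g @` (cone R K `&` [set y | eucl_dist y x < r]).
  apply/seteqP; split => [y [cy yr]|_ [y [cy yr] <-]].
    exists (g y); last exact: gK.
    by split; [exact: gcone|rewrite /= -giso gK gx].
  by split; [exact: gcone|rewrite /= -gx giso].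
rewrite -[in LHS](image_id (_ `&` _)); apply/esym/hausdorff3_raw_isometry.
by move=> p q _ _; exact: giso.
Qed.

(** The closed ball lies between the open balls of radii r and lam r, whose measures differ by the
    factor lam^3; then lam tends to 1. *)
Lemma cone_closed_ball (R : realType) K (x : 'rV[R]_K.+3) (r : R) :
  cone R K x -> 0 < r ->
  hausdorff3_raw (eucl_ball x r `&` cone R K) =
  ((4 / 3 * pi * r ^+ 3)%:E * hausdorff3_raw (unit_cube3 R))%E.
Proof.
move=> cx r0; apply/eqP; rewrite eq_le; apply/andP; split; last first.
  rewrite -(cone_open_ball cx r0); apply: hausdorff3_raw_mono => y [cy yr].
  by split => //; rewrite /eucl_ball /= eucl_distC ltW.
apply: (@le_of_le_mul_powers _ _ _ 3) => [|lam lam1].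
  rewrite mule_ge0 ?hausdorff3_raw_ge0// lee_fin.
  by rewrite !mulr_ge0 ?exprn_ge0 ?pi_ge0 ?(ltW r0).
have lr0 : 0 < lam * r by rewrite mulr_gt0// (lt_trans _ lam1).
have -> : ((lam ^+ 3)%:E * ((4 / 3 * pi * r ^+ 3)%:E * hausdorff3_raw (unit_cube3 R)) =
    (4 / 3 * pi * (lam * r) ^+ 3)%:E * hausdorff3_raw (unit_cube3 R))%E.
  by rewrite muleA -EFinM; congr (_%:E * _)%E; ring.
rewrite -(cone_open_ball cx lr0); apply: hausdorff3_raw_mono => y [yr cy].
split => //; rewrite /= eucl_distC; apply: le_lt_trans yr _.
by rewrite ltr_pMl.
Qed.

Lemma coneC_cone (R : realType) k : coneC R k = cone R k.+1.
Proof.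
apply/seteqP; split => x.
- move=> [x4 xl] [|l] lk; first by rewrite expr0 mul1r.
  by rewrite -x4; have := xl l.+1; rewrite addn4 /=; apply.
- move=> cx; have x4 := cx 0%N isT; rewrite expr0 mul1r in x4.
  split=> // l /andP[_ lk]; rewrite /= x4 addn4; exact: cx.
Qed.

Theorem theorem1p3 (R : realType) (k : nat) (x : 'rV[R]_k.+4) (r : R)
    (hx : coneC R k x) (hr : 0 < r) :
  hausdorff3 (eucl_ball x r `&` coneC R k) = (4 / 3 * pi * r ^+ 3)%:E.
Proof.
rewrite coneC_cone in hx *; rewrite /hausdorff3 (cone_closed_ball hx hr).
have c0 := unit_cube3_gt0 R; have coo := unit_cube3_lty R.
(* The quotient of the unit cube's measure by itself is 1 because that measure is nonzero and
   finite. *)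
rewrite -muleA divee ?mule1 ?gt_eqF//.
by rewrite ge0_fin_numE// ltW.
Qed.
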